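(* Let $E$ be a Banach space and let $T\colon S\to\mathscr{L}(E)$ be a bounded representation of the commutative semigroup $S$. Then the following assertions are equivalent. (a) $T$ is quasi-compact. (b) The unitary spectrum $\sigma_{\mathrm{uni}}(T)$ consists of Riesz points of $T$.
   Context: $(S,+)$ is a commutative semigroup with neutral element $0$; $S$ carries no topology and is not assumed cancellative. All vector spaces are complex, and $\mathscr{L}(E)$ is the Banach algebra of bounded linear operators on $E$. A representation of $S$ in a unital Banach algebra $A$ is a map $T\colon S\to A$, $s\mapsto T_s$, with $T_{s+t}=T_sT_t$ for all $s,t\in S$ and $T_0=\mathbf{1}$ (the unit of $A$); it is bounded if $\sup_{s\in S}\|T_s\|<\infty$. A unitary semigroup character is a map $\chi\colon S\to\{z\in\mathbb{C}:|z|=1\}$ with $\chi(s+t)=\chi(s)\chi(t)$ and $\chi(0)=1$; the set of all these is $S^{*,\mathrm{uni}}$. The unitary spectrum $\sigma_{\mathrm{uni}}(T)$ of a bounded representation $T\colon S\to A$ is the set of all $\chi\in S^{*,\mathrm{uni}}$ such that the left ideal of $A$ generated by $\{\chi(s)\mathbf{1}-T_s: s\in S\}$ is not equal to $A$ (so it is empty if $A=\{0\}$). For $T\colon S\to\mathscr{L}(E)$ and $\chi\in S^{*,\mathrm{uni}}$ put $\ker(\chi-T)=\{x\in E: T_sx=\chi(s)x\text{ for all }s\in S\}$. For a closed subspace $F$ invariant under all $T_s$, $T|_F\colon S\to\mathscr{L}(F)$ is the restricted representation $s\mapsto T_s|_F$. A character $\chi\in S^{*,\mathrm{uni}}$ is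 a pole of $T$ if there is a projection $P\in\mathscr{L}(E)$ onto $\ker(\chi-T)$ with $PT_s=T_sP$ for all $s\in S$ and $\chi\notin\sigma_{\mathrm{uni}}(T|_{\ker P})$; it is a Riesz point if in addition $\dim\ker(\chi-T)<\infty$. $T$ is quasi-compact if there are $s\in S$ and a compact operator $K$ on $E$ with $\|T_s-K\|<1$. *)

(* Defs.v *)
From HB Require Import structures.
From mathcomp Require Import all_boot all_order all_algebra.
From mathcomp Require Import complex.
From mathcomp Require Import all_classical all_reals all_analysis.

Set Implicit Arguments.
Unset Strict Implicit.
Unset Printing Implicit Defensive.

Import Order.TTheory GRing.Theory Num.Theory.
Import numFieldNormedType.Exports.

Local Open Scope classical_set_scope.
Local Open Scope complex_scope.
Local Open Scope ring_scope.

Section BoundedOperators.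
Variables (R : realType) (E : normedModType R[i]).

Definition bop_pred : {pred E -> E} := fun f => `[< linear f /\ continuous f >].

Lemma bop_predP (f : E -> E) :
  reflect (linear f /\ continuous f) (f \in bop_pred).
Proof. exact: asboolP. Qed.

Lemma bop_pred_submod : subsemimod_closed bop_pred.
Proof.
split; first split.
- apply/bop_predP; split=> [a x y|]; last exact: cst_continuous.
  by rewrite /= scaler0 addr0.
- move=> f g /bop_predP[fl fc] /bop_predP[gl gc]; apply/bop_predP; split.
    move=> a x y; rewrite -![(f + g) _]/(f _ + g _) fl gl scalerDr.
    exact: addrACA.
  by move=> x; apply: cvgD; [exact: fc|exact: gc].
- move=> a f /bop_predP[fl fc]; apply/bop_predP; split.
    move=> b x y; rewrite -![(a *: f) _]/(a *: f _) fl scalerDr !scalerA.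
    by rewrite mulrC.
  by move=> x; apply: cvgZl_tmp; exact: fc.
Qed.

HB.instance Definition _ := GRing.isSubmodClosed.Build _ _ bop_pred
  bop_pred_submod.

Definition bop := {f : E -> E | f \in bop_pred}.

HB.instance Definition _ := SubChoice.on bop.
HB.instance Definition _ := [SubChoice_isSubLmodule of bop by <:].

Definition bop_fun (T : bop) : E -> E := val T.
Coercion bop_fun : bop >-> Funclass.

Lemma bop_linear (T : bop) : linear T.
Proof. by case/bop_predP: (valP T). Qed.

Lemma bop_continuous (T : bop) : continuous T.
Proof. by case/bop_predP: (valP T). Qed.

HB.instance Definition _ (T : bop) :=
  GRing.isLinear.Build R[i] E E *:%R (bop_fun T) (@bop_linear T).

Lemma bop_ext (T U : bop) : (T : E -> E) =1 U -> T = U.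
Proof. by move=> TU; apply/val_inj/funext. Qed.

Lemma bop_id_subproof : idfun \in bop_pred.
Proof. by apply/bop_predP; split=> // x. Qed.

Definition bop_id : bop := exist _ (idfun : E -> E) bop_id_subproof.

Lemma bop_comp_subproof (T U : bop) : (T : E -> E) \o U \in bop_pred.
Proof.
apply/bop_predP; split=> [a x y|x]; first by rewrite /= !linearP.
by apply: continuous_comp; exact: bop_continuous.
Qed.

Definition bop_comp (T U : bop) : bop :=
  exist _ ((T : E -> E) \o U) (bop_comp_subproof T U).

Lemma bop_compA : associative bop_comp.
Proof. by move=> T U V; exact: bop_ext. Qed.

Lemma bop_comp1o : left_id bop_id bop_comp.
Proof. by move=> T; exact: bop_ext. Qed.

Lemma bop_compo1 : right_id bop_id bop_comp.
Proof. by move=> T; exact: bop_ext. Qed.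

Lemma bop_compDl : left_distributive bop_comp +%R.
Proof. by move=> T U V; exact: bop_ext. Qed.

Lemma bop_compDr : right_distributive bop_comp +%R.
Proof. by move=> T U V; apply: bop_ext => x; exact: linearD. Qed.

HB.instance Definition _ := GRing.Zmodule_isPzRing.Build bop
  bop_compA bop_comp1o bop_compo1 bop_compDl bop_compDr.

(* Norms over [R[i]] are [R[i]]-valued (with zero imaginary part), so the
   supremum is taken over real parts. *)
Definition opnorm (T : bop) : R :=
  sup [set complex.Re `|T x| | x in [set x : E | `|x| <= 1]].

Lemma ReK_norm (x : E) : (complex.Re `|x|)%:C = `|x|.
Proof. by rewrite RRe_real ?normr_real. Qed.

Lemma opnorm_has_sup (T : bop) :
  has_sup [set complex.Re `|T x| | x in [set x : E | `|x| <= 1]].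
Proof.
split; first by exists (complex.Re `|T 0|), 0 => //=; rewrite normr0 ler01.
have /linear_boundedP := (linear_bounded_continuous T).2 (@bop_continuous T).
move=> /pinfty_ex_gt0[r r0 Tr].
exists (complex.Re r) => _ [x /= x1 <-].
rewrite -lecR ReK_norm RRe_real ?gtr0_real//.
by rewrite (le_trans (Tr x))// ler_piMr// ltW.
Qed.

Lemma opnorm_ge0 (T : bop) : 0 <= opnorm T.
Proof.
apply: (ub_le_sup (opnorm_has_sup T).2); exists 0 => /=.
  by rewrite normr0 ler01.
by rewrite linear0 normr0.
Qed.

Lemma opnorm_ubP (T : bop) (M : R) : 0 <= M ->
  (opnorm T <= M) <-> (forall x, `|T x| <= M%:C * `|x|).
Proof.
move=> M0; split=> [TM x|TM]; last first.
  apply: ge_sup; first exact: (opnorm_has_sup T).1.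
  move=> _ [x /= x1 <-]; rewrite -lecR ReK_norm (le_trans (TM x))//.
  by rewrite ler_piMr// lecR.
have [->|x0] := eqVneq x 0; first by rewrite linear0 !normr0 mulr0.
have nx0 : 0 < `|x| by rewrite normr_gt0.
have nTx : `|T (`|x|^-1 *: x)| <= M%:C.
  rewrite -ReK_norm lecR; apply: le_trans TM.
  apply: (ub_le_sup (opnorm_has_sup T).2); exists (`|x|^-1 *: x) => //=.
  by rewrite normrZ normfV normr_id mulVf ?gt_eqF.
by move: nTx; rewrite linearZ /= normrZ normfV normr_id ler_pdivrMl// mulrC.
Qed.

Lemma le_opnorm (T : bop) x : `|T x| <= (opnorm T)%:C * `|x|.
Proof. by move: x; apply/opnorm_ubP => //; exact: opnorm_ge0. Qed.

Definition opnormC (T : bop) : R[i] := (opnorm T)%:C.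

Lemma opnormC_triangle (T U : bop) : opnormC (T + U) <= opnormC T + opnormC U.
Proof.
rewrite /opnormC -rmorphD lecR; apply/opnorm_ubP.
  by rewrite addr_ge0 ?opnorm_ge0.
move=> x; rewrite rmorphD mulrDl (le_trans (ler_normD (T x) (U x)))//.
by rewrite lerD ?le_opnorm.
Qed.

Lemma opnormC_eq0 (T : bop) : opnormC T = 0 -> T = 0.
Proof.
move=> T0; apply: bop_ext => x; apply/normr0_eq0/le_anti/andP; split=> //.
by rewrite (le_trans (le_opnorm T x))// -/(opnormC T) T0 mul0r.
Qed.

Lemma opnormCZ_le a (T : bop) : opnormC (a *: T) <= `|a| * opnormC T.
Proof.
have [r r0 ra] : exists2 r : R, 0 <= r & `|a| = r%:C.
  exists (complex.Re `|a|); last by rewrite RRe_real ?normr_real.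
  by have := normr_ge0 a; rewrite lecE => /andP[].
rewrite /opnormC ra -rmorphM /= lecR.
apply/opnorm_ubP; first by rewrite mulr_ge0 ?opnorm_ge0.
move=> x; rewrite rmorphM /= -mulrA -ra.
have -> : (a *: T : bop) x = a *: T x by [].
by rewrite normrZ ler_wpM2l ?le_opnorm.
Qed.

Lemma opnormCZ a (T : bop) : opnormC (a *: T) = `|a| * opnormC T.
Proof.
have [->|a0] := eqVneq a 0.
  apply/le_anti; move: (opnormCZ_le 0 T); rewrite normr0 mul0r => ->.
  by rewrite /= lecR opnorm_ge0.
apply/le_anti; rewrite opnormCZ_le /=.
rewrite -ler_pdivlMl ?normr_gt0// -normfV (le_trans _ (opnormCZ_le _ _))//.
by rewrite scalerA mulVf// scale1r.
Qed.

HB.instance Definition _ := Lmodule_isNormed.Build R[i] bop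
  opnormC_triangle opnormCZ opnormC_eq0.

Lemma bop_scalerAl a (T U : bop) : a *: (T * U) = (a *: T) * U.
Proof. exact: bop_ext. Qed.

Lemma bop_scalerAr a (T U : bop) : a *: (T * U) = T * (a *: U).
Proof. by apply: bop_ext => x; exact/esym/linearZ. Qed.

Lemma bop_normM_le (T U : bop) : `|T * U| <= `|T| * `|U|.
Proof.
rewrite /Num.norm /= /opnormC -rmorphM /= lecR.
apply/opnorm_ubP; first by rewrite mulr_ge0 ?opnorm_ge0.
move=> x; rewrite rmorphM /= -mulrA (le_trans (le_opnorm T _))//.
by rewrite ler_wpM2l ?le_opnorm// lecR opnorm_ge0.
Qed.

Lemma bop_norm1_le : `|1 : bop| <= 1.
Proof.
rewrite /Num.norm /= /opnormC lecR; apply/opnorm_ubP => // x.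
by rewrite mul1r.
Qed.

End BoundedOperators.

Notation "''L' ( E )" := (bop E) (format "''L' ( E )") : type_scope.

Section Subspaces.
Variables (R : realType) (E : normedModType R[i]).

Definition subsp (F : submodClosed E) := {x : E | x \in F}.

HB.instance Definition _ (F : submodClosed E) := SubChoice.on (subsp F).
HB.instance Definition _ (F : submodClosed E) :=
  [SubChoice_isSubLmodule of subsp F by <:].

Definition subsp_norm (F : submodClosed E) (x : subsp F) : R[i] := `|val x|.

Lemma subsp_norm_triangle F (x y : subsp F) :
  subsp_norm (x + y) <= subsp_norm x + subsp_norm y.
Proof. by rewrite /subsp_norm raddfD ler_normD. Qed.

Lemma subsp_normZ F a (x : subsp F) :
  subsp_norm (a *: x) = `|a| * subsp_norm x.
Proof. by rewrite /subsp_norm linearZ normrZ. Qed.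

Lemma subsp_norm_eq0 F (x : subsp F) : subsp_norm x = 0 -> x = 0.
Proof. by move=> /normr0_eq0 x0; apply: val_inj; rewrite raddf0. Qed.

HB.instance Definition _ F := Lmodule_isNormed.Build R[i] (subsp F)
  (@subsp_norm_triangle F) (@subsp_normZ F) (@subsp_norm_eq0 F).

Definition bop_restr_fun (F : submodClosed E) (T : 'L(E))
    (TF : {homo T : x / x \in F}) (x : subsp F) : subsp F :=
  exist _ (T (val x)) (TF (val x) (valP x)).

Lemma bop_restr_subproof (F : submodClosed E) (T : 'L(E))
    (TF : {homo T : x / x \in F}) :
  bop_restr_fun TF \in @bop_pred R (subsp F).
Proof.
have Tl : linear (bop_restr_fun TF).
  by move=> a x y; apply: val_inj; rewrite /= !linearP.
apply/bop_predP; split=> //.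
pose f := GRing.isLinear.Build _ _ _ _ _ Tl.
pose g : {linear subsp F -> subsp F} := HB.pack (bop_restr_fun TF) f.
apply: (@bounded_linear_continuous _ _ _ g); apply/linear_boundedP.
have /linear_boundedP := (linear_bounded_continuous T).2 (@bop_continuous _ _ T).
by apply: filterS => r Tr x; exact: Tr (val x).
Qed.

Definition bop_restr (F : submodClosed E) (T : 'L(E))
    (TF : {homo T : x / x \in F}) : 'L(subsp F) :=
  exist _ (bop_restr_fun TF) (bop_restr_subproof TF).

Definition bop_ker (P : 'L(E)) : {pred E} := fun x => P x == 0.

Lemma bop_ker_submod P : subsemimod_closed (bop_ker P).
Proof.
split; first split.
- by apply/eqP; exact: linear0.
- by move=> x y /eqP Px /eqP Py; apply/eqP; rewrite linearD /= Px Py addr0.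
- by move=> a x /eqP Px; apply/eqP; rewrite linearZ /= Px scaler0.
Qed.

HB.instance Definition _ P := GRing.isSubmodClosed.Build _ _ (bop_ker P)
  (bop_ker_submod P).

Lemma bop_ker_homo (P T : 'L(E)) : P * T = T * P ->
  {homo T : x / x \in bop_ker P}.
Proof.
move=> PT x /eqP Px; apply/eqP.
have PTx : P (T x) = T (P x) := congr1 (fun U : 'L(E) => U x) PT.
by rewrite [LHS]PTx [X in T X]Px linear0.
Qed.

End Subspaces.

Section LeftIdeals.
Variable A : pzRingType.

Definition left_ideal (I : set A) :=
  [/\ I 0, forall x y, I x -> I y -> I (x + y) & forall a x, I x -> I (a * x)].

Definition left_ideal_gen (G : set A) : set A := smallest left_ideal G.

End LeftIdeals.

Section Representations.
Variables (R : realType) (S : nmodType).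

Definition unitary_character (chi : S -> R[i]) :=
  [/\ forall s, `|chi s| = 1, forall s t, chi (s + t) = chi s * chi t
    & chi 0 = 1].

(* Only the algebras [L(E)] occur, so the spectrum is stated for these; [E] is
   arbitrary, since it is also taken over the subspaces [ker P].  MathComp's
   [algType] would exclude the zero ring [L({0})]. *)
Section UnitarySpectrum.
Variable E : normedModType R[i].

Definition representation (T : S -> 'L(E)) :=
  (forall s t, T (s + t) = T s * T t) /\ T 0 = 1.

Definition bounded_rep (T : S -> 'L(E)) :=
  exists M : R, forall s, `|T s| <= M%:C.

Definition uni_spectrum (T : S -> 'L(E)) : set (S -> R[i]) :=
  [set chi | unitary_character chi /\
    left_ideal_gen (range (fun s => chi s *: (1 : 'L(E)) - T s)) <> setT].

End UnitarySpectrum.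

Variable E : normedModType R[i].

Definition ker_char (T : S -> 'L(E)) (chi : S -> R[i]) : set E :=
  [set x | forall s, T s x = chi s *: x].

Definition restr_rep (T : S -> 'L(E)) (F : submodClosed E)
    (TF : forall s, {homo T s : x / x \in F}) : S -> 'L(subsp F) :=
  fun s => bop_restr (TF s).

Definition pole (T : S -> 'L(E)) (chi : S -> R[i]) :=
  unitary_character chi /\
  exists (P : 'L(E)) (PT : forall s, P * T s = T s * P),
    [/\ P * P = P, range P = ker_char T chi
      & ~ uni_spectrum (restr_rep (fun s => bop_ker_homo (PT s))) chi].

Definition finite_dimensional (V : set E) :=
  exists (n : nat) (v : 'I_n -> E),
    V = range (fun a : 'I_n -> R[i] => \sum_(i < n) a i *: v i).

Definition riesz_point (T : S -> 'L(E)) (chi : S -> R[i]) :=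
  pole T chi /\ finite_dimensional (ker_char T chi).

Definition compact_operator (K : 'L(E)) :=
  precompact (K @` [set x : E | `|x| <= 1]).

Definition quasi_compact (T : S -> 'L(E)) :=
  exists (s : S) (K : 'L(E)), compact_operator K /\ `|T s - K| < 1.

End Representations.

(* Main.v *)
(* If [T] is not quasi-compact, consider on L(E) the seminorm [ess x], the
   limsup over [t] of the distance of [x T_t] to the compact operators: it is
   invariant under [T], it is nonzero at the identity and it kills operators of
   finite rank.  On the commutant of [T] the operators [T_s] act as commuting
   isometries of this seminorm.  Comparing the resolvents of an isometry at
   radii 1 and r < 1 through the 2^m-th roots of unity yields a unimodular
   approximate eigenvalue; iterating over finitely many [s], and passing to a
   limit along an ultrafilter, gives a unitary character [chi] with joint
   approximate eigenvectors.  They show that [chi] belongs to the spectrum, and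
   that it still does modulo any commuting finite-rank projection, so that
   [chi] is not a Riesz point.

   Conversely, let [T] be quasi-compact and rescale by a unitary character so
   that it becomes the trivial one.  Averages [C] of the operators [U_t] with
   [C (1 - U_t)] small satisfy [C = C U_t] up to a small error for a [U_t] that
   is nearly compact.  Hence they converge in norm along an ultrafilter, to a
   projection [P] onto the fixed space; this space is finite-dimensional by
   Riesz' theorem.  On [ker P] some average has norm less than 1, and since
   [1 - C] is in the ideal generated by the [1 - U_t], so is the identity. *)
From HB Require Import structures.
Require Import Defs.
From mathcomp Require Import all_boot all_order all_algebra.
From mathcomp Require Import complex.
From mathcomp Require Import all_classical all_reals all_analysis.
From mathcomp Require Import ring lra.

Set Implicit Arguments.
Unset Strict Implicit.
Unset Printing Implicit Defensive.

Import Order.TTheory GRing.Theory Num.Theory.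
Import numFieldNormedType.Exports.
Local Open Scope classical_set_scope.
Local Open Scope complex_scope.
Local Open Scope ring_scope.

(* Sealed: unification is slow when it is allowed to unfold norms. *)
HB.lock Definition nm (R : realType) (V : normedZmodType R[i]) (x : V) : R :=
  complex.Re `|x|.
Canonical nm_unlockable := Unlockable nm.unlock.

(** * Real-valued norms and operator bounds *)

Section RealNorm.
Variable R : realType.

Section Zmod.
Variable V : normedZmodType R[i].
Implicit Types x y : V.

Lemma nmE x : (nm x)%:C = `|x|.
Proof. by rewrite unlock RRe_real ?normr_real. Qed.

Lemma le_nm x (r : R) : (`|x| <= r%:C) = (nm x <= r).
Proof. by rewrite -nmE lecR. Qed.

Lemma lt_nm x (r : R) : (`|x| < r%:C) = (nm x < r).
Proof. by rewrite -nmE ltcR. Qed.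

Lemma nm_ge0 x : 0 <= nm x.
Proof. by rewrite -lecR nmE normr_ge0. Qed.

Lemma norm1_nm x : `|x| = 1 -> nm x = 1.
Proof. by rewrite unlock => ->. Qed.

Lemma nm0 : nm (0 : V) = 0.
Proof. by rewrite unlock normr0. Qed.

Lemma nm_eq0 x : nm x = 0 -> x = 0.
Proof. by move=> x0; apply/normr0_eq0; rewrite -nmE x0. Qed.

Lemma nm_gt0 x : (0 < nm x) = (x != 0).
Proof. by rewrite -normr_gt0 -nmE ltcR. Qed.

Lemma nmD x y : nm (x + y) <= nm x + nm y.
Proof. by rewrite -lecR rmorphD /= !nmE ler_normD. Qed.

Lemma nmN x : nm (- x) = nm x.
Proof. by rewrite unlock normrN. Qed.

Lemma nmC x y : nm (x - y) = nm (y - x).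
Proof. by rewrite -nmN opprB. Qed.

Lemma nm_dist z x y : nm (x - y) <= nm (x - z) + nm (z - y).
Proof. by rewrite -[x - y](subrKA z) nmD. Qed.

Lemma nm_sum I (r : seq I) (P : pred I) (F : I -> V) :
  nm (\sum_(i <- r | P i) F i) <= \sum_(i <- r | P i) nm (F i).
Proof.
by elim/big_ind2: _ => [|x r1 y r2 xr yr|//]; rewrite ?nm0 ?(le_trans (nmD _ _)) ?lerD.
Qed.
End Zmod.

Lemma nmR (r : R) : nm (r%:C) = `|r|.
Proof.
by rewrite unlock normc_def /= expr0n /= addr0 sqrtr_sqr.
Qed.

Lemma nm1 : nm (1 : R[i]) = 1.
Proof. by rewrite unlock normr1. Qed.

Lemma nmM (a b : R[i]) : nm (a * b) = nm a * nm b.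
Proof. by apply: complexI; rewrite rmorphM /= !nmE normrM. Qed.

Section Mod.
Variable V : normedModType R[i].
Implicit Types x y : V.

Lemma nmZ (a : R[i]) x : nm (a *: x) = nm a * nm x.
Proof. by apply: complexI; rewrite rmorphM /= !nmE normrZ. Qed.

Lemma gt0_real (e : R[i]) : 0 < e -> exists2 r : R, 0 < r & e = r%:C.
Proof.
move=> e0; exists (complex.Re e); last by rewrite RRe_real ?gtr0_real.
by rewrite -ltcR RRe_real ?gtr0_real.
Qed.

Lemma ball_nm x y (r : R) : ball x r%:C y = (nm (x - y) < r) :> Prop.
Proof. by rewrite -ball_normE /= lt_nm. Qed.

Lemma nbhs_nm x (A : set V) :
  nbhs x A <-> exists2 r : R, 0 < r & forall y, nm (x - y) < r -> A y.
Proof.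
split=> [/nbhs_ballP[_ /= /gt0_real[r r0 ->] xA]|[r r0 xA]].
  by exists r => // y xy; apply: xA; rewrite ball_nm.
by apply/nbhs_ballP; exists r%:C; rewrite /= ?ltcR// => y; rewrite ball_nm; exact: xA.
Qed.

Lemma cvg_nm (T : Type) (F : set_system T) (FF : Filter F) (f : T -> V) y :
  (f t @[t --> F] --> y) <->
  (forall e : R, 0 < e -> \forall t \near F, nm (f t - y) < e).
Proof.
split=> [/cvgrPdist_lt fy e e0|fy].
  have := fy e%:C; rewrite ltcR => /(_ e0).
  by apply: filterS => t; rewrite lt_nm nmC.
apply/cvgrPdist_lt => _ /gt0_real[r r0 ->].
by have := fy r r0; apply: filterS => t; rewrite lt_nm nmC.
Qed.

Lemma closure_nm (A : set V) x :
  closure A x <-> forall e : R, 0 < e -> exists2 y, A y & nm (x - y) < e.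
Proof.
split=> [Ax e e0|Ax B /nbhs_nm[e e0 xB]].
  have /Ax[y [Ay]] : nbhs x [set y | nm (x - y) < e] by apply/nbhs_nm; exists e.
  by exists y.
by have [y Ay xy] := Ax e e0; exists y; split=> //; exact: xB.
Qed.

End Mod.

Lemma continuous_nm (V W : normedModType R[i]) (f : {linear V -> W}) (M : R) :
  (forall x, nm (f x) <= M * nm x) -> continuous f.
Proof.
move=> fM; apply: bounded_linear_continuous; apply/linear_boundedP.
exists (`|M|%:C); split; first by rewrite ger0_real// lecR.
move=> y yM x; rewrite -nmE (@le_trans _ _ (`|M|%:C * `|x|))//.
  rewrite -nmE -rmorphM lecR (le_trans (fM x))//.
  by rewrite ler_wpM2r ?nm_ge0 ?ler_norm.
by rewrite ler_wpM2r// ltW.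
Qed.

Section Bop.
Variable E : normedModType R[i].
Implicit Types T U : 'L(E).

Lemma nm_opnorm T : nm T = opnorm T.
Proof. by rewrite unlock. Qed.

Lemma nm_bop T (x : E) : nm (T x) <= nm T * nm x.
Proof.
by rewrite -lecR rmorphM /= !nmE -[`|T|]/((opnorm T)%:C) le_opnorm.
Qed.

Lemma nm_bopP T (M : R) : 0 <= M ->
  nm T <= M <-> forall x : E, nm (T x) <= M * nm x.
Proof.
move=> M0; split=> [TM x|TM].
  by rewrite (le_trans (nm_bop T x))// ler_wpM2r ?nm_ge0.
rewrite nm_opnorm; apply/(opnorm_ubP T M0) => x.
by have := TM x; rewrite -lecR rmorphM /= !nmE.
Qed.

Lemma nm_comp T U : nm (T * U) <= nm T * nm U.
Proof. by have := bop_normM_le T U; rewrite -!nmE -rmorphM lecR. Qed.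

Lemma bop_of (f : E -> E) (M : R) : linear f ->
  (forall x, nm (f x) <= M * nm x) -> {T : 'L(E) | forall x, T x = f x}.
Proof.
move=> fl fM.
pose h := GRing.isLinear.Build _ _ _ _ _ fl.
pose g : {linear E -> E} := HB.pack f h.
have fP : f \in @bop_pred R E.
  by apply/bop_predP; split=> //; exact: (@continuous_nm _ _ g M).
by exists (exist _ f fP).
Qed.

Lemma bopD T U (x : E) : (T + U : 'L(E)) x = T x + U x. Proof. by []. Qed.
Lemma bopN T (x : E) : (- T : 'L(E)) x = - T x. Proof. by []. Qed.
Lemma bopM T U (x : E) : (T * U : 'L(E)) x = T (U x). Proof. by []. Qed.
Lemma bopZ a T (x : E) : (a *: T : 'L(E)) x = a *: T x. Proof. by []. Qed.
Lemma bop1 (x : E) : (1 : 'L(E)) x = x. Proof. by []. Qed.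
Lemma bop_0 (x : E) : (0 : 'L(E)) x = 0. Proof. by []. Qed.
Lemma bop_sum I (r : seq I) (P : pred I) (F : I -> 'L(E)) (x : E) :
  (\sum_(i <- r | P i) F i : 'L(E)) x = \sum_(i <- r | P i) F i x.
Proof. by elim/big_rec2: _ => // i y1 y2 _ <-. Qed.
End Bop.
End RealNorm.

(** * Ultrafilters and compactness of complex disks *)

Lemma fmap_ultra (T U : Type) (f : T -> U) (F : set_system T) :
  UltraFilter F -> UltraFilter (f @ F).
Proof.
move=> FU; split=> [|G GF FG]; first exact: fmap_proper_filter.
apply/seteqP; split=> A; last exact: FG.
move=> GA; rewrite /fmap /=.
have [//|FA] := in_ultra_setVsetC (f @^-1` A) FU.
have GcA : G (~` A) by apply: FG.
by have [x []] := filter_ex (filterI GA GcA).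
Qed.

Section Disk.
Variable R : realType.

Lemma nm_ReIm (a b : R[i]) :
  nm (a - b) <= `|complex.Re a - complex.Re b| + `|complex.Im a - complex.Im b|.
Proof.
case: a b => [u v] [x y] /=.
have -> : (u +i* v - (x +i* y))%C = (u - x)%:C + 'i * (v - y)%:C.
  by apply/eqP; rewrite eq_complex /= !mul0r !mul1r !subr0 !addr0 !add0r !eqxx.
rewrite (le_trans (nmD _ _))// nmM !nmR lerD2l.
have -> : nm ('i : R[i]) = 1.
  by rewrite unlock normc_def /= expr0n /= expr1n add0r sqrtr1.
by rewrite mul1r.
Qed.

(** Along an ultrafilter the real and imaginary parts converge, since each stays in a compact real
    segment; the modulus bound passes to the limit. *)
Lemma disk_compact (M : R) : compact [set a : R[i]^o | nm a <= M].
Proof.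
rewrite compact_ultra => F FU FM.
have Rec (a : R[i]) : `|complex.Re a| <= nm a.
  by have := normc_ge_Re a; rewrite -nmE lecR.
have Imc (a : R[i]) : `|complex.Im a| <= nm a.
  case: a => x y; rewrite -lecR nmE normc_def lecR.
  by rewrite -sqrtr_sqr ler_wsqrtr //= lerDr sqr_ge0.
have cvgF (f : R[i]^o -> R) : (forall a, `|f a| <= nm a) ->
    exists x : R, f a @[a --> F] --> x.
  move=> fn; have Ff := fmap_ultra f FU.
  have := @segment_compact R (- M) M; rewrite compact_ultra => /(_ _ Ff).
  have FfM : (f @ F) `[- M, M]%classic.
    rewrite /fmap /=; apply: filterS FM => a /= aM.
    by rewrite in_itv /= -ler_norml (le_trans (fn a)).
  by move=> /(_ FfM)[x [_]]; exists x.
have [x Fx] := cvgF _ Rec; have [y Fy] := cvgF _ Imc.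
have Fc : F --> ((x +i* y)%C : R[i]^o).
  apply/(@cvg_nm _ _ _ F _ id) => e e0.
  have e2 : 0 < e / 2 by lra.
  have /cvgrPdist_lt /(_ _ e2) Fx2 := Fx.
  have /cvgrPdist_lt /(_ _ e2) Fy2 := Fy.
  near=> a.
  have : `|x - complex.Re a| < e / 2 by near: a.
  have : `|y - complex.Im a| < e / 2 by near: a.
  move=> ya xa; rewrite (le_lt_trans (nm_ReIm _ _))//= distrC [`|_ - y|]distrC.
  by lra.
exists (x +i* y)%C; split=> //=.
apply/ler_addgt0Pl => e e0.
have /(@cvg_nm _ _ _ F _ id)/(_ e e0) Fe := Fc.
have [a [/= aM ae]] := filter_ex (filterI FM Fe).
rewrite -[(x +i* y)%C](subrK a) (le_trans (nmD _ _))// nmC lerD//.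
exact: ltW.
Unshelve. all: end_near. Qed.

End Disk.

(** * Finite-dimensional subspaces *)

Section FiniteDim.
Variables (R : realType) (E : normedModType R[i]).
Implicit Types (s : seq E) (x y v w : E) (M : R).

(** Bounding the coefficients makes the set a continuous image of a product of disks, hence compact;
    [lspan] is the increasing union of these sets. *)
Fixpoint bspan s M : set E :=
  if s is v :: s' then
    [set p.1 *: v + p.2 | p in [set a : R[i]^o | nm a <= M] `*` bspan s' M]
  else [set 0].

Definition lspan s : set E := [set x | exists M, bspan s M x].

Lemma bspanS s M M' : M <= M' -> bspan s M `<=` bspan s M'.
Proof.
move=> MM'; elim: s => //= v s IH _ [[a w] /= [aM wM] <-].
by exists (a, w) => //; split=> /=; [exact: le_trans aM MM'|exact: IH].
Qed.

Lemma bspan_compact s M : compact (bspan s M).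
Proof.
elim: s => [|v s IH] /=; first exact: compact_set1.
apply: continuous_compact; last exact: compact_setX (@disk_compact R M) IH.
apply: continuous_subspaceT => p; apply: cvgD; last exact: cvg_snd.
by apply: cvgZr_tmp; exact: cvg_fst.
Qed.

Lemma bspan_closed s M : closed (bspan s M).
Proof. by apply: compact_closed; [exact: norm_hausdorff|exact: bspan_compact]. Qed.

Lemma lspan0 s : lspan s 0.
Proof.
exists 0; elim: s => //= v s IH; exists (0, 0) => /=; last by rewrite scale0r addr0.
by split=> //=; rewrite nm0.
Qed.

Lemma lspanP v s x : lspan (v :: s) x <-> exists a w, lspan s w /\ x = a *: v + w.
Proof.
split=> [[M [[a w] /= [aM wM] <-]]|[a [w [[M wM] ->]]]].
  by exists a, w; split=> //; exists M.
exists (Num.max (nm a) M), (a, w) => //; split=> /=.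
  by rewrite le_max lexx.
by apply: bspanS wM; rewrite le_max lexx orbT.
Qed.

Lemma lspanD s x y : lspan s x -> lspan s y -> lspan s (x + y).
Proof.
elim: s x y => [|v s IH] x y.
  by move=> [M /= ->] [M' /= ->]; exists 0; rewrite /= addr0.
move=> /lspanP[a [w [sw ->]]] /lspanP[b [z [sz ->]]].
apply/lspanP; exists (a + b), (w + z); split; first exact: IH.
by rewrite scalerDl addrACA.
Qed.

Lemma lspanZ s c x : lspan s x -> lspan s (c *: x).
Proof.
elim: s x => [|v s IH] x; first by move=> [M /= ->]; exists 0; rewrite /= scaler0.
move=> /lspanP[a [w [sw ->]]].
apply/lspanP; exists (c * a), (c *: w); split; first exact: IH.
by rewrite scalerDr scalerA.
Qed.

Lemma lspan_mem s x : x \in s -> lspan s x.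
Proof.
elim: s => // v s IH; rewrite inE => /orP[/eqP->|/IH sx]; apply/lspanP.
  by exists 1, 0; rewrite scale1r addr0; split=> //; exact: lspan0.
by exists 0, x; rewrite scale0r add0r.
Qed.

(** Points of the span within distance 1 of [x] all lie in one compact [bspan], which therefore
    contains the limit [x]. *)
Lemma bounded_closed_lspan s (C : R) :
  (forall x, lspan s x -> bspan s (C * nm x) x) -> 0 <= C -> closed (lspan s).
Proof.
move=> sC C0 x /closure_nm sx; exists (C * (nm x + 1)).
apply: bspan_closed; apply/closure_nm => e e0.
have e1 : 0 < Num.min e 1 by rewrite lt_min e0 ltr01.
have [y sy xy] := sx _ e1; exists y; last first.
  by rewrite (lt_le_trans xy)// ge_min lexx.
apply: bspanS (sC _ sy); rewrite ler_wpM2l//.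
rewrite -[y](subrK x) (le_trans (nmD _ _))// addrC lerD2l nmC ltW//.
by rewrite (lt_le_trans xy)// ge_min lexx orbT.
Qed.

(** Induction on [s]. If [v] depends on the tail, it gets coefficient 0. Otherwise [v] has positive
    distance [d] from the closed span of the tail, so its coefficient is at most [nm x / d]. *)
Lemma lspan_bounded s :
  exists2 C : R, 0 <= C & forall x, lspan s x -> bspan s (C * nm x) x.
Proof.
elim: s => [|v s [C C0 sC]]; first by exists 0 => // x [M].
have cls := bounded_closed_lspan sC C0.
have [sv|sv] := pselect (lspan s v).
  exists C => // x /lspanP[a [w [sw xE]]].
  have sx : lspan s x by rewrite xE; apply: lspanD => //; exact: lspanZ.
  exists (0, x) => /=; last by rewrite scale0r add0r.
  by split=> /=; [rewrite nm0 mulr_ge0// nm_ge0|exact: sC].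
have [d d0 vd] : exists2 d : R, 0 < d & forall w, lspan s w -> d <= nm (v - w).
  apply: contrapT => nd; apply: sv; apply: cls; apply/closure_nm => e e0.
  apply: contrapT => ne; apply: nd; exists e => // w sw.
  by rewrite leNgt; apply/negP => we; apply: ne; exists w.
(* The two summands bound the coefficient of [v] and, through the norm of [w], the coefficients of
   [w]. *)
pose D := d^-1 + C * (1 + nm v / d).
have vd0 : 0 <= nm v / d by rewrite divr_ge0 ?nm_ge0// ltW.
have D0 : 0 <= D by rewrite addr_ge0 ?invr_ge0 ?(ltW d0)// mulr_ge0// addr_ge0.
exists D => // x /lspanP[a [w [sw xE]]].
have nx := nm_ge0 x.
have ad : nm a <= nm x / d.
  have [->|a0] := eqVneq a 0; first by rewrite nm0 divr_ge0// ltW.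
  rewrite ler_pdivlMr// xE.
  have -> : a *: v + w = a *: (v - (- a^-1) *: w).
    by rewrite scaleNr opprK scalerDr scalerA mulfV// scale1r.
  by rewrite nmZ ler_wpM2l ?nm_ge0//; apply: vd; exact: lspanZ.
have nw : nm w <= (1 + nm v / d) * nm x.
  have -> : w = x - a *: v by rewrite xE addrC addKr.
  rewrite (le_trans (nmD _ _))// nmN nmZ mulrDl mul1r lerD2l.
  by rewrite (le_trans (ler_wpM2r (nm_ge0 v) ad))// mulrAC -mulrA mulrC mulrAC.
exists (a, w) => //; split=> /=.
  rewrite (le_trans ad)// mulrC ler_wpM2r// /D lerDl mulr_ge0// addr_ge0//.
apply: bspanS (sC _ sw); rewrite mulrDl (le_trans (ler_wpM2l C0 nw))//.
by rewrite mulrA lerDr mulr_ge0// invr_ge0 ltW.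
Qed.

Lemma lspan_closed s : closed (lspan s).
Proof. by have [C C0 sC] := lspan_bounded s; exact: bounded_closed_lspan sC C0. Qed.

Lemma finite_rank_compact s (T : 'L(E)) :
  (forall x, lspan s (T x)) -> compact_operator T.
Proof.
move=> sT; have [C C0 sC] := lspan_bounded s.
exists (bspan s (C * nm T)); last by split; [exact: bspan_compact|exact: bspan_closed].
move=> _ [x /= x1 <-]; apply: bspanS (sC _ (sT x)); rewrite ler_wpM2l//.
rewrite (le_trans (nm_bop _ _))// ler_piMr ?nm_ge0//.
by rewrite -le_nm.
Qed.

Lemma lspan_finite_dimensional s : finite_dimensional (lspan s).
Proof.
exists (size s), (fun i => s`_i); apply/seteqP; split=> x.
  elim: s x => [|v s IH] x; first by move=> [M /= ->]; exists (fun=> 0); rewrite ?big_ord0.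
  move=> /lspanP[a [w [/IH[b _ <-] ->]]].
  exists (fun i => if unlift ord0 i is Some j then b j else a) => //.
  rewrite big_ord_recl unlift_none /=; congr (_ + _); apply: eq_bigr => i _.
  by rewrite liftK.
move=> [b _ <-]; apply: (big_ind (lspan s)); first exact: lspan0.
  exact: lspanD.
by move=> i _; apply: lspanZ; apply: lspan_mem; rewrite mem_nth.
Qed.

Lemma finite_dimensional_lspan (V : set E) :
  finite_dimensional V -> exists s, V `<=` lspan s.
Proof.
move=> [n [v ->]]; exists [seq v i | i <- enum 'I_n] => _ [a _ <-].
apply: big_ind; [exact: lspan0|exact: lspanD|].
by move=> i _; apply: lspanZ; apply: lspan_mem; rewrite map_f// mem_enum.
Qed.

Lemma precompact_net (A : set E) (e : R) : precompact A -> 0 < e ->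
  exists s, (forall y, y \in s -> A y) /\
    forall x, A x -> exists2 y, y \in s & nm (x - y) < e.
Proof.
rewrite precompactE compact_cover => Ac e0.
have [|x /closure_nm/(_ e e0)[y Ay xy]|D DA Dc] := Ac E A (fun x => ball x e%:C).
- by move=> y _; apply: ball_open; rewrite ltcR.
- by exists y => //; rewrite ball_nm nmC.
exists (finmap.enum_fset D); split=> [y yD|x Ax].
  by have := DA _ yD; rewrite inE.
have [y /= yD] := Dc x (subset_closure Ax).
by rewrite ball_nm nmC; exists y.
Qed.

(* Riesz: the half-radius net gives approximations by its span with errors
   2^-k. *)
Lemma riesz_finite (V : set E) s :
  (forall x y, V x -> V y -> V (x + y)) -> (forall a x, V x -> V (a *: x)) ->
  V 0 -> (forall y, y \in s -> V y) ->
  (forall x, V x -> nm x <= 1 -> exists2 y, y \in s & nm (x - y) <= 2^-1) ->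
  V = lspan s.
Proof.
move=> VD VZ V0 sV Vs.
have lV : lspan s `<=` V.
  elim: s sV {Vs} => [_ x [M /= ->]//|v s IH sV x /lspanP[a [w [sw ->]]]].
  apply: VD; first by apply: VZ; apply: sV; rewrite inE eqxx.
  by apply: IH => // y ys; apply: sV; rewrite inE ys orbT.
have approx k x : V x -> exists2 w, lspan s w & nm (x - w) <= 2^-1 ^+ k * nm x.
  move=> Vx; elim: k => [|k [w sw xw]].
    by exists 0; [exact: lspan0|rewrite subr0 expr0 mul1r].
  have [xw0|xw0] := eqVneq (x - w) 0.
    by exists w => //; rewrite xw0 nm0 mulr_ge0 ?nm_ge0// exprn_ge0.
  have nxw : 0 < nm (x - w) by rewrite nm_gt0.
  (* The normalised error is a unit vector of [V]; replacing it by a net point halves the error. *)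
  pose c : R[i] := (nm (x - w))^-1%:C.
  have ncxw : nm (c *: (x - w)) = 1.
    by rewrite nmZ nmR ger0_norm ?invr_ge0 ?(ltW nxw)// mulVf// gt_eqF.
  have Vxw : V (c *: (x - w)).
    apply: (VZ); apply: VD => //; rewrite -scaleN1r; apply: VZ; exact: lV.
  have [|y ys yc] := Vs _ Vxw; first by rewrite ncxw.
  exists (w + (nm (x - w))%:C *: y).
    by apply: lspanD => //; apply: lspanZ; exact: lspan_mem.
  have -> : x - (w + (nm (x - w))%:C *: y) =
      (nm (x - w))%:C *: (c *: (x - w) - y).
    rewrite scalerBr scalerA -rmorphM /= mulfV ?gt_eqF// scale1r.
    by rewrite opprD addrA.
  rewrite nmZ nmR (ger0_norm (ltW nxw)) exprS -mulrA mulrC.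
  by rewrite ler_pM ?nm_ge0.
apply/seteqP; split=> // x Vx; apply: lspan_closed; apply/closure_nm => e e0.
have : (2^-1 : R) ^+ n @[n --> \oo] --> (0 : R).
  by apply: cvg_expr; rewrite ger0_norm// invf_lt1// ltr1n.
move=> /cvgrPdist_lt/(_ (e / (nm x + 1))).
have nx1 : 0 < nm x + 1 by rewrite ltr_wpDl ?nm_ge0.
move=> /(_ (divr_gt0 e0 nx1))[k _ /(_ k (leqnn k))] /=.
rewrite sub0r normrN ger0_norm ?exprn_ge0// ltr_pdivlMr// => ke.
have [w sw xw] := approx k x Vx; exists w => //.
by rewrite (le_lt_trans xw)// (le_lt_trans _ ke)// ler_wpM2l ?exprn_ge0// lerDl.
Qed.

End FiniteDim.

(** * Generated left ideals *)

Section LeftIdealGen.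
Variables (A : pzRingType) (I : Type) (g : I -> A).

Lemma left_ideal_genP (a : A) : left_ideal_gen (range g) a <->
  exists l : seq (A * I), a = \sum_(p <- l) p.1 * g p.2.
Proof.
split=> [|[l ->] J [[J0 JD JM] gJ]]; last first.
  by apply: (big_ind J) => // p _; apply: JM; apply: gJ; exists p.2.
move=> /(_ [set a | exists l : seq (A * I), a = \sum_(p <- l) p.1 * g p.2]).
apply; split; last by move=> _ [i _ <-]; exists [:: (1, i)]; rewrite big_seq1 mul1r.
split; first by exists [::]; rewrite big_nil.
  by move=> x y [l ->] [l' ->]; exists (l ++ l'); rewrite big_cat.
move=> b x [l ->]; exists [seq (b * p.1, p.2) | p <- l].
by rewrite big_map mulr_sumr; apply: eq_bigr => p _; rewrite mulrA.
Qed.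

(** A left ideal containing 1 is the whole ring; spectra are used below in this form. *)
Lemma left_ideal_gen_full : left_ideal_gen (range g) <> setT <->
  ~ exists l : seq (A * I), 1 = \sum_(p <- l) p.1 * g p.2.
Proof.
split=> [nT [l l1]|n1 T1]; last first.
  by apply: n1; apply/left_ideal_genP; rewrite T1.
apply: nT; apply/seteqP; split=> // a _; apply/left_ideal_genP.
exists [seq (a * p.1, p.2) | p <- l].
rewrite big_map -[LHS]mulr1 l1 mulr_sumr.
by apply: eq_bigr => p _; rewrite mulrA.
Qed.

End LeftIdealGen.

(** * Compact operators *)

Section CompactOperators.
Variables (R : realType) (E : normedModType R[i]).
Implicit Types K A : 'L(E).

Lemma compact_op_sub K (B : set E) : compact B ->
  (forall x, nm x <= 1 -> B (K x)) -> compact_operator K.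
Proof.
move=> Bc KB; apply: (@precompact_subset _ _ B).
  by move=> _ [x /= x1 <-]; apply: KB; rewrite -le_nm.
by apply: compact_precompact => //; exact: norm_hausdorff.
Qed.

Lemma compact_op_set K : compact_operator K ->
  exists2 B : set E, compact B & forall x, nm x <= 1 -> B (K x).
Proof.
move=> [B KB [Bc _]]; exists B => // x x1; apply: KB; exists x => //=.
by rewrite le_nm.
Qed.

Lemma compact_op0 : compact_operator (0 : 'L(E)).
Proof. by apply: (@compact_op_sub _ [set 0]) => //; exact: compact_set1. Qed.

Lemma compact_opD K A : compact_operator K -> compact_operator A ->
  compact_operator (K + A).
Proof.
move=> /compact_op_set[B Bc KB] /compact_op_set[B' B'c AB'].
apply: (@compact_op_sub _ [set p.1 + p.2 | p in B `*` B']).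
  apply: continuous_compact; last exact: compact_setX.
  apply: continuous_subspaceT => p.
  by apply: cvgD; [exact: cvg_fst|exact: cvg_snd].
by move=> x x1; exists (K x, A x) => //; split=> /=; [exact: KB|exact: AB'].
Qed.

Lemma compact_opMl A K : compact_operator K -> compact_operator (A * K).
Proof.
move=> /compact_op_set[B Bc KB]; apply: (@compact_op_sub _ (A @` B)).
  by apply: continuous_compact => //; apply/continuous_subspaceT/bop_continuous.
by move=> x x1; exists (K x) => //; exact: KB.
Qed.

Lemma compact_opZ (a : R[i]) K : compact_operator K -> compact_operator (a *: K).
Proof. by move=> /(compact_opMl (a *: (1 : 'L(E)))); rewrite -bop_scalerAl mul1r. Qed.

Lemma compact_op_ball K (M : R) : compact_operator K ->
  exists2 B : set E, compact B & forall x, nm x <= M -> B (K x).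
Proof.
move=> /(compact_opZ (Num.max 1 M)%:C) /compact_op_set[B Bc KB].
exists B => // x xM.
have M1 : 0 < Num.max 1 M by rewrite lt_max ltr01.
have := KB ((Num.max 1 M)^-1%:C *: x); rewrite bopZ linearZ /= scalerA.
rewrite -rmorphM /= mulfV ?gt_eqF// scale1r; apply.
rewrite nmZ nmR ger0_norm ?invr_ge0 ?(ltW M1)// ler_pdivrMl// mulr1.
by rewrite (le_trans xM)// le_max lexx orbT.
Qed.

Lemma compact_opMr K A : compact_operator K -> compact_operator (K * A).
Proof.
move=> /(compact_op_ball (nm A))[B Bc KB]; apply: (compact_op_sub Bc) => x x1.
by apply: KB; rewrite (le_trans (nm_bop _ _))// ler_piMr ?nm_ge0.
Qed.

Lemma compact_op_net K (M e : R) : compact_operator K -> 0 < e ->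
  exists s : seq E, forall x, nm x <= M -> exists2 y : E, y \in s & nm (K x - y) < e.
Proof.
move=> /(compact_op_ball M)[B Bc KB] e0.
have Bp := compact_precompact (@norm_hausdorff _ _) Bc.
have [s [_ sB]] := precompact_net Bp e0.
by exists s => x /KB /sB.
Qed.

(** Modulo the compact operators [V] and [V - K] agree, hence so do their powers. If
    [nm (V - K) < 1], powers of [V] thus come arbitrarily close to compact operators. *)
Lemma compact_op_pow (V K : 'L(E)) n : compact_operator K ->
  compact_operator (V ^+ n - (V - K) ^+ n).
Proof.
move=> Kc; elim: n => [|n IH]; first by rewrite !expr0 subrr; exact: compact_op0.
have -> : V ^+ n.+1 - (V - K) ^+ n.+1 =
    V * (V ^+ n - (V - K) ^+ n) + K * (V - K) ^+ n.
  by rewrite !exprS mulrBr mulrBl opprD opprK addrA.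
by apply: compact_opD; [exact: compact_opMl|exact: compact_opMr].
Qed.

End CompactOperators.

Lemma subrBB (V : zmodType) (a b c d : V) : (a - b) - (c - d) = (a - c) - (b - d).
Proof. by rewrite !opprB addrACA [RHS]addrACA [- c + _]addrC. Qed.

(** * Neumann series *)

Section Neumann.
Variables (R : realType) (E : completeNormedModType R[i]).

Lemma nm_exp_cvg0 (q c e : R) : 0 <= q -> q < 1 -> 0 < e ->
  exists N, forall n, (N <= n)%N -> q ^+ n * c < e.
Proof.
move=> q0 q1 e0; have c1 : 0 < `|c| + 1 by rewrite ltr_wpDl.
have : q ^+ n @[n --> \oo] --> (0 : R) by apply: cvg_expr; rewrite ger0_norm.
move=> /cvgrPdist_lt/(_ (e / (`|c| + 1)) (divr_gt0 e0 c1))[N _ NP].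
exists N => n /NP /=; rewrite sub0r normrN ger0_norm ?exprn_ge0//.
rewrite ltr_pdivlMr//; apply: le_lt_trans; rewrite ler_wpM2l ?exprn_ge0//.
by rewrite (le_trans (ler_norm c))// lerDl.
Qed.

Lemma nm_powbop (D : 'L(E)) n x : nm ((D ^+ n : 'L(E)) x) <= nm D ^+ n * nm x.
Proof.
elim: n => [|n IH]; first by rewrite !expr0 mul1r.
rewrite !exprS bopM (le_trans (nm_bop _ _))// -mulrA.
by rewrite ler_wpM2l ?nm_ge0.
Qed.

(** For [nm D < 1] this lower bound on [1 - D] yields the Cauchy property, uniqueness of solutions
    and the bound on the inverse below. *)
Lemma nm_1subV (D : 'L(E)) (y : E) : (1 - nm D) * nm y <= nm (y - D y).
Proof.
rewrite mulrBl mul1r lerBlDr -{1}[y](subrK (D y)).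
by rewrite (le_trans (nmD _ _))// lerD2l nm_bop.
Qed.

Lemma neumann_solve (D : 'L(E)) x : nm D < 1 -> exists y, y - D y = x.
Proof.
move=> D1; pose u n : E := (\sum_(k < n) D ^+ k : 'L(E)) x.
have uE n : u n - D (u n) = x - (D ^+ n : 'L(E)) x.
  elim: n => [|n IH]; first by rewrite /u big_ord0 bop_0 linear0 expr0 !subrr.
  have -> : u n.+1 = u n + (D ^+ n : 'L(E)) x by rewrite /u big_ord_recr.
  by rewrite linearD /= opprD addrACA IH exprS bopM addrA subrK.
have D0 := nm_ge0 D.
have cu : cauchy (u n @[n --> \oo]).
  apply: cauchy_exP => _ /gt0_real[e e0 ->].
  (* The factor [1 - nm D] pays for [nm_1subV], the 2 for the two remainders [D ^+ n x] and
     [D ^+ N x]. *)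
  have d0 : 0 < e * (1 - nm D) / 2 by rewrite divr_gt0// mulr_gt0// subr_gt0.
  have [N NP] := nm_exp_cvg0 (nm x) D0 D1 d0.
  exists (u N); exists N => // n /= Nn; rewrite ball_nm.
  have := nm_1subV D (u N - u n).
  have -> : u N - u n - D (u N - u n) =
    (D ^+ n : 'L(E)) x - (D ^+ N : 'L(E)) x.
    by rewrite linearB /= subrBB !uE subrBB subrr sub0r opprB.
  move=> /le_trans/(_ (nmD _ _)); rewrite nmN.
  have := nm_powbop D n x; have := nm_powbop D N x.
  have := NP _ Nn; have := NP _ (leqnn N) => h1 h2 h3 h4 h5.
  rewrite -(ltr_pM2l (_ : 0 < 1 - nm D)) ?subr_gt0//; lra.
have /cauchy_cvgP/cvg_ex[y uy] := cu.
exists y; have h1 : u n - D (u n) @[n --> \oo] --> y - D y.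
  by apply: cvgB => //; apply: continuous_cvg => //; exact: bop_continuous.
have h2 : u n - D (u n) @[n --> \oo] --> x.
  apply/cvg_nm => e e0; have [N NP] := nm_exp_cvg0 (nm x) D0 D1 e0.
  exists N => // n /= Nn; rewrite uE addrAC subrr add0r nmN.
  exact: le_lt_trans (nm_powbop D n x) (NP _ Nn).
exact: (cvg_unique (@norm_hausdorff _ _) h1 h2).
Qed.

Lemma neumann (D : 'L(E)) : nm D < 1 -> exists G : 'L(E), G * (1 - D) = 1.
Proof.
move=> D1; have /choice[g gE] := fun x => @neumann_solve D x D1.
have uniq y z : y - D y = z - D z -> y = z.
  move=> yz; apply/subr0_eq/nm_eq0/le_anti; rewrite nm_ge0 andbT.
  have := nm_1subV D (y - z).
  have -> : y - z - D (y - z) = 0.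
    by rewrite linearB /= subrBB yz subrr.
  by rewrite nm0 pmulr_rle0 ?subr_gt0.
have gl : linear g.
  move=> a x y; apply: uniq; rewrite gE linearP /= opprD addrACA gE -scalerBr.
  by rewrite gE.
have gM x : nm (g x) <= (1 - nm D)^-1 * nm x.
  have D1' : 0 < 1 - nm D by rewrite subr_gt0.
  by rewrite ler_pdivlMl// -{2}(gE x) nm_1subV.
have [G GE] := bop_of gl gM.
by exists G; apply: bop_ext => x; rewrite bopM GE; apply: uniq; rewrite gE.
Qed.

End Neumann.

(** * Approximate eigenvalues *)

Section RootsOfUnity.
Variable C : numClosedFieldType.

(* With [N = 2 ^ m] and [w] ranging over the [N]-th roots of unity, the last
   component is [\prod_(v != w) (1 - v T) (1 - r v T)]; the sum formula is the
   partial fraction identity for the difference of the resolvents at [1] and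
   [r]. *)
Lemma unity_root_factors m (T : {poly C}) (r : C) :
  exists l : seq (C * {poly C}), let N := (2 ^ m)%N in
  [/\ size l = N,
    forall q, q \in l -> `|q.1| = 1 /\
      (1 - (r * q.1)%:P * T) * ((1 - q.1%:P * T) * q.2) =
      (1 - T ^+ N) * (1 - (r ^+ N)%:P * T ^+ N)
  & \sum_(q <- l) (q.1 * (r - 1))%:P * T * q.2 =
      (N%:R * (r ^+ N - 1))%:P * T ^+ N].
Proof.
elim: m T r => [|m IH] T r.
  exists [:: (1, 1)]; rewrite /= expn0 !expr1; split=> //.
    by move=> q; rewrite inE => /eqP -> /=; rewrite normr1 !mulr1 mul1r mulrC.
  by rewrite big_seq1 /= !mulr1.
(* With [s] a square root of [v], the factor 1 - v T^2 splits into (1 - s T)(1 + s T). Each root [v]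
   thus gives the roots [s] and [-s] of doubled order, and the factors of opposite sign go into the
   cofactor. *)
have [l /= [sl lP lS]] := IH (T ^+ 2) (r ^+ 2).
pose s (q : C * {poly C}) := sqrtC q.1.
have s2 q : s q ^+ 2 = q.1 by rewrite sqrtCK.
pose g (e : C) (q : C * {poly C}) :=
  (e * s q, q.2 * ((1 + (e * s q)%:P * T) * (1 + (r * (e * s q))%:P * T))).
exists ([seq g 1 q | q <- l] ++ [seq g (-1) q | q <- l]).
rewrite !expnSr; split.
- by rewrite size_cat !size_map sl muln2 addnn.
- have gP e q : e ^+ 2 = 1 -> q \in l -> `|(g e q).1| = 1 /\
      (1 - (r * (g e q).1)%:P * T) * ((1 - (g e q).1%:P * T) * (g e q).2) =
      (1 - T ^+ (2 ^ m * 2)) * (1 - (r ^+ (2 ^ m * 2))%:P * T ^+ (2 ^ m * 2)).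
    move=> e2 /lP[q1 qE]; split=> /=.
      apply/eqP; rewrite -(@pexpr_eq1 _ _ 2)// -normrX exprMn e2 mul1r s2.
      by rewrite q1.
    rewrite [(2 ^ m * 2)%N]mulnC !exprM -qE -s2.
    have -> : (s q ^+ 2) = (e * s q) ^+ 2 by rewrite exprMn e2 mul1r.
    set b := e * s q; ring.
  move=> q; rewrite mem_cat => /orP[] /mapP[q' q'l ->]; apply: gP => //.
    by rewrite expr1n.
  by rewrite sqrrN expr1n.
rewrite big_cat /= !big_map -big_split /= [(2 ^ m * 2)%N]mulnC !exprM.
rewrite natrM -mulrA polyCM -mulrA -lS mulr_sumr; apply: eq_bigr => q _ /=.
rewrite -s2; set b := s q; ring.
Qed.

End RootsOfUnity.

(** * Polynomials in an operator *)

Section PolyEval.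
Variables (R : realType) (E : normedModType R[i]) (T : 'L(E)).
Implicit Types p q : {poly R[i]}.

(** Carries the identities of [unity_root_factors], proved among commuting polynomials, over to
    operators. *)
Definition bop_horner p : 'L(E) := \sum_(i < size p) p`_i *: T ^+ i.

Lemma bop_horner_wide n p : (size p <= n)%N ->
  bop_horner p = \sum_(i < n) p`_i *: T ^+ i.
Proof.
move=> pn; rewrite /bop_horner (big_ord_widen _ (fun i => p`_i *: T ^+ i) pn).
rewrite big_mkcond; apply: eq_bigr => i _; case: ltnP => // pi.
by rewrite nth_default// scale0r.
Qed.

Lemma bop_hornerD p q : bop_horner (p + q) = bop_horner p + bop_horner q.
Proof.
pose n := maxn (size p) (size q).
rewrite (@bop_horner_wide n) ?size_polyD//.
rewrite (@bop_horner_wide n p) ?leq_maxl// (@bop_horner_wide n q) ?leq_maxr//.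
by rewrite -big_split; apply: eq_bigr => i _; rewrite coefD scalerDl.
Qed.

Lemma bop_hornerZ a p : bop_horner (a *: p) = a *: bop_horner p.
Proof.
rewrite (@bop_horner_wide (size p)) ?size_scale_leq// scaler_sumr.
by apply: eq_bigr => i _; rewrite coefZ scalerA.
Qed.

Lemma bop_hornerC a : bop_horner a%:P = a *: (1 : 'L(E)).
Proof.
rewrite (@bop_horner_wide 1) ?size_polyC ?leq_b1// big_ord1 coefC eqxx.
by rewrite expr0.
Qed.

Lemma bop_hornerMX p : bop_horner (p * 'X) = bop_horner p * T.
Proof.
have [->|p0] := eqVneq p 0; first by rewrite mul0r /bop_horner size_poly0 big_ord0 mul0r.
rewrite /bop_horner size_mulX// big_ord_recl coefMX eqxx scale0r add0r mulr_suml.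
apply: eq_bigr => i _; rewrite coefMX /= exprSr.
by apply: bop_ext => x; rewrite bopM.
Qed.

Lemma bop_hornerM p q : bop_horner (p * q) = bop_horner p * bop_horner q.
Proof.
have comm r : bop_horner r * T = T * bop_horner r.
  rewrite /bop_horner mulr_suml mulr_sumr; apply: eq_bigr => i _.
  by rewrite -bop_scalerAl -bop_scalerAr -exprSr exprS.
elim/poly_ind: p => [|p c IH].
  by rewrite mul0r /bop_horner size_poly0 big_ord0 mul0r.
rewrite mulrDl -mulrA ['X * q]mulrC mulrA mul_polyC !bop_hornerD bop_hornerZ.
rewrite !bop_hornerMX IH bop_hornerC mulrDl -!mulrA comm; congr (_ + _).
by rewrite -bop_scalerAl mul1r.
Qed.

Lemma bop_hornerX : bop_horner 'X = T.
Proof. by rewrite -['X]mul1r bop_hornerMX -polyC1 bop_hornerC scale1r mul1r. Qed.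

Lemma bop_hornerXn n : bop_horner ('X ^+ n) = T ^+ n.
Proof.
elim: n => [|n IH]; first by rewrite !expr0 -polyC1 bop_hornerC scale1r.
by rewrite !exprS bop_hornerM IH bop_hornerX.
Qed.

Lemma bop_horner1B a p : bop_horner (1 - a%:P * p) = 1 - a *: bop_horner p.
Proof.
by rewrite mul_polyC -scaleNr bop_hornerD -polyC1 bop_hornerC bop_hornerZ scale1r scaleNr.
Qed.

Lemma bop_horner_sum I (r : seq I) (F : I -> {poly R[i]}) :
  bop_horner (\sum_(i <- r) F i) = \sum_(i <- r) bop_horner (F i).
Proof.
elim/big_rec2: _ => [|i x y _ <-]; last exact: bop_hornerD.
by rewrite /bop_horner size_poly0 big_ord0.
Qed.

Lemma bop_horner_comm (A : 'L(E)) p :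
  A * T = T * A -> A * bop_horner p = bop_horner p * A.
Proof.
move=> AT; rewrite /bop_horner mulr_suml mulr_sumr; apply: eq_bigr => i _.
rewrite -bop_scalerAl -bop_scalerAr; congr (_ *: _).
exact: (commrX i AT).
Qed.

End PolyEval.

(** * The essential seminorm of a representation *)

Definition ess_bound (R : realType) (S : nmodType) (E : normedModType R[i])
    (T : S -> 'L(E)) (x : 'L(E)) (r : R) :=
  0 <= r /\ exists t, forall u, exists K,
    compact_operator K /\ nm (x * T (t + u) - K) <= r.

(* limsup over [t], directed by divisibility in [S], of the distance of
   [x * T t] to the compact operators. *)
HB.lock Definition ess (R : realType) (S : nmodType) (E : normedModType R[i])
  (T : S -> 'L(E)) (x : 'L(E)) : R := inf [set r | ess_bound T x r].
Canonical ess_unlockable := Unlockable ess.unlock.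

Section EssentialSeminorm.
Variables (R : realType) (S : nmodType) (E : normedModType R[i]).
Variable T : S -> 'L(E).
Hypotheses (T_rep : representation T) (T_bounded : bounded_rep T).
Implicit Types (s t u : S) (x y z : 'L(E)) (r : R).

Lemma rep_bound : exists2 M : R, 0 <= M & forall s, nm (T s) <= M.
Proof.
have [M TM] := T_bounded; exists M; last by move=> s; rewrite -le_nm.
by rewrite -lecR (le_trans _ (TM 0))// normr_ge0.
Qed.

Lemma rep_comm s t : T s * T t = T t * T s.
Proof. by rewrite -!T_rep.1 addrC. Qed.

Lemma rep_pow s n : T s ^+ n = T (s *+ n).
Proof.
elim: n => [|n IH]; first by rewrite expr0 mulr0n T_rep.2.
by rewrite exprS IH mulrS T_rep.1.
Qed.

Local Notation ess_bound := (ess_bound T).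
Local Notation ess := (ess T).

Lemma ess_bound_ex x : exists r, ess_bound x r.
Proof.
have [M M0 TM] := rep_bound.
exists (nm x * M); split; first by rewrite mulr_ge0 ?nm_ge0.
exists 0 => u; exists 0; split; first exact: compact_op0.
by rewrite subr0 (le_trans (nm_comp _ _))// ler_wpM2l ?nm_ge0.
Qed.

Lemma ess_has_inf x : has_inf [set r | ess_bound x r].
Proof. by split; [exact: ess_bound_ex|exists 0 => r []]. Qed.

Lemma ess_le x r : ess_bound x r -> ess x <= r.
Proof. by rewrite unlock => xr; apply: ge_inf => //; exact: (ess_has_inf x).2. Qed.

Lemma ess_lb x r : (forall r', ess_bound x r' -> r <= r') -> r <= ess x.
Proof.
rewrite unlock => xr.
by apply: lb_le_inf; [exact: ess_bound_ex|move=> r'; exact: xr].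
Qed.

Lemma ess_ge0 x : 0 <= ess x.
Proof. by apply: ess_lb => r []. Qed.

(** Common core of the multiplicative estimates below; [c = 0] is treated apart because the general
    case divides by [c]. *)
Lemma ess_scale c x y : 0 <= c ->
  (forall r, ess_bound x r -> ess_bound y (c * r)) -> ess y <= c * ess x.
Proof.
rewrite le_eqVlt => /orP[/eqP<- xy|c0 xy].
  have [r xr] := ess_bound_ex x.
  by rewrite mul0r; have := ess_le (xy _ xr); rewrite mul0r.
by rewrite -ler_pdivrMl//; apply: ess_lb => r /xy/ess_le; rewrite ler_pdivrMl.
Qed.

Lemma essD x y : ess (x + y) <= ess x + ess y.
Proof.
rewrite -lerBlDr; apply: ess_lb => r [r0 [t tr]].
rewrite lerBlDl -lerBlDr; apply: ess_lb => r' [r'0 [t' tr']].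
rewrite lerBlDl; apply: ess_le; split; first by rewrite addr_ge0.
(* The sum lies beyond both thresholds, so both approximations are available there. *)
exists (t + t') => u.
have [K [Kc xK]] := tr (t' + u); have [K' [K'c yK]] := tr' (t + u).
exists (K + K'); split; first exact: compact_opD.
have e1 : t + (t' + u) = t + t' + u by rewrite addrA.
have e2 : t' + (t + u) = t + t' + u by rewrite addrCA addrA.
move: xK yK; rewrite e1 e2 => xK yK.
have -> : (x + y) * T (t + t' + u) - (K + K') =
    (x * T (t + t' + u) - K) + (y * T (t + t' + u) - K').
  by rewrite mulrDl opprD addrACA.
exact: le_trans (nmD _ _) (lerD xK yK).
Qed.

Lemma essMl x y : ess (x * y) <= nm x * ess y.
Proof.
apply: ess_scale; first exact: nm_ge0.
move=> r [r0 [t tr]]; split; first by rewrite mulr_ge0 ?nm_ge0.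
exists t => u; have [K [Kc yK]] := tr u.
exists (x * K); split; first exact: compact_opMl.
by rewrite -mulrA -mulrBr (le_trans (nm_comp _ _))// ler_wpM2l ?nm_ge0.
Qed.

Lemma essZ (a : R[i]) x r : nm a <= r -> ess (a *: x) <= r * ess x.
Proof.
move=> ar; apply: ess_scale; first exact: le_trans (nm_ge0 _) ar.
move=> r' [r'0 [t tr]]; split; first by rewrite mulr_ge0// (le_trans (nm_ge0 _) ar).
exists t => u; have [K [Kc yK]] := tr u.
exists (a *: K); split; first exact: compact_opZ.
by rewrite -bop_scalerAl -scalerBr nmZ ler_pM ?nm_ge0.
Qed.

(** Invariance comes from the limsup: a threshold [t] for [x] also serves [x * T s], and a threshold
    [t] for [x * T s] gives the threshold [s + t] for [x]. *)
Lemma ess_rep x s : ess (x * T s) = ess x.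
Proof.
apply/le_anti/andP; split; rewrite -[leRHS]mul1r; apply: ess_scale => // r.
  rewrite mul1r => -[r0 [t tr]]; split=> //; exists t => u.
  have [K [Kc xK]] := tr (s + u); exists K; split; first exact: Kc.
  have e : s + (t + u) = t + (s + u) by rewrite addrCA.
  by rewrite -mulrA -T_rep.1 e.
rewrite mul1r => -[r0 [t tr]]; split=> //; exists (s + t) => u.
have [K [Kc xK]] := tr u; exists K; split; first exact: Kc.
have e : s + t + u = s + (t + u) by rewrite addrA.
by rewrite e T_rep.1 mulrA.
Qed.

Lemma ess_compact x : (forall s, compact_operator (x * T s)) -> ess x = 0.
Proof.
move=> xc; apply/le_anti; rewrite ess_ge0 andbT; apply: ess_le; split=> //.
by exists 0 => u; exists (x * T (0 + u)); rewrite subrr nm0.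
Qed.

(** An essential bound below 1 at the identity is itself a witness of quasi-compactness. *)
Lemma ess1 : ~ quasi_compact T -> 1 <= ess 1.
Proof.
move=> nqc; apply: ess_lb => r [r0 [t tr]]; rewrite leNgt; apply/negP => r1.
apply: nqc; exists (t + 0); have [K [Kc xK]] := tr 0; exists K; split=> //.
by rewrite lt_nm (le_lt_trans _ r1)//; move: xK; rewrite mul1r.
Qed.

Lemma essN x : ess (- x) = ess x.
Proof.
have le y : ess (- y) <= ess y.
  by rewrite -scaleN1r -[leRHS]mul1r essZ// nmN nm1.
by apply/le_anti/andP; split; [exact: le|have := le (- x); rewrite opprK].
Qed.

Lemma essB x y : ess (x - y) <= ess x + ess y.
Proof. by rewrite -(essN y) essD. Qed.

Lemma ess_sum I (l : seq I) (F : I -> 'L(E)) :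
  ess (\sum_(i <- l) F i) <= \sum_(i <- l) ess (F i).
Proof.
elim: l => [|i l IH]; last by rewrite !big_cons (le_trans (essD _ _))// lerD2l.
by rewrite !big_nil -[X in ess X](scale0r 0) -[leRHS](mul0r (ess 0)) essZ ?nm0.
Qed.

Definition commutant x := forall s, x * T s = T s * x.

Lemma commutant1 : commutant 1.
Proof. by move=> s; rewrite mul1r mulr1. Qed.

Lemma commutantM x y : commutant x -> commutant y -> commutant (x * y).
Proof. by move=> xc yc s; rewrite -mulrA yc mulrA xc mulrA. Qed.

Lemma commutant_horner s (P : {poly R[i]}) : commutant (bop_horner (T s) P).
Proof. by move=> t; rewrite -(bop_horner_comm P (rep_comm t s)). Qed.

(** On the commutant, left multiplication by [T s] is thus an isometry of the seminorm. *)
Lemma ess_repl x s : commutant x -> ess (T s * x) = ess x.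
Proof. by move=> xc; rewrite -xc ess_rep. Qed.

(** The vector [z] is a polynomial in [T s] applied to [x], and [B] bounds the norms of the
    polynomials involved. As [B] is chosen before [x], approximate eigenvector relations of [x] for
    other elements can be made precise enough beforehand to survive in [z]. *)
Lemma approx_eigen1 s (c : R) : 0 < c -> c <= 1 ->
  exists2 B : R, 0 <= B & forall x, commutant x -> 0 < ess x ->
  exists (l : R[i]) z, [/\ nm l = 1, commutant z, ess x <= ess z,
    ess (T s * z - l *: z) <= c * ess z &
    forall y, commutant y -> ess (y * z) <= B * ess (y * x)].
Proof.
move=> c0 c1.
(* The bound [aX] below loses a factor 8 / c^2, so this [d] bounds each term of the partial fraction
   sum by half of [ess x]. The choice of [m] makes the other side exceed that total. *)
pose d := c ^+ 2 / 16; pose r := 1 - d.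
have c21 : c ^+ 2 <= 1 by rewrite expr_le1// ltW.
have c20 : 0 < c ^+ 2 by rewrite exprn_gt0.
have d0 : 0 < d by rewrite /d; lra.
have r0 : 0 <= r by rewrite /r /d; lra.
have r1 : r < 1 by rewrite /r; lra.
have [m rm] : exists m, r ^+ (2 ^ m) < 2^-1.
  have h : 0 < 2^-1 :> R by lra.
  have [m mP] := nm_exp_cvg0 1 r0 r1 h; exists m.
  by have := mP (2 ^ m)%N (ltnW (ltn_expl m (ltnSn 1))); rewrite mulr1.
have [l /= [sl lP lS]] := unity_root_factors m ('X : {poly R[i]}) r%:C.
(* For each root the candidates for [z] are [a q * x], essentially a resolvent applied to [x], and
   its image [e q * x] under [1 - q.1 *: T s]. *)
pose a (q : R[i] * {poly R[i]}) := bop_horner (T s) q.2.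
pose e (q : R[i] * {poly R[i]}) := (1 - q.1 *: T s) * a q.
have eE q : e q = bop_horner (T s) ((1 - q.1%:P * 'X) * q.2).
  by rewrite bop_hornerM bop_horner1B bop_hornerX.
pose B := \sum_(q <- l) (nm (a q) + nm (e q)).
have B0 : 0 <= B by apply: sumr_ge0 => q _; rewrite addr_ge0 ?nm_ge0.
exists B => // x xc x0.
have aB q : q \in l -> nm (a q) <= B /\ nm (e q) <= B.
  move=> ql; rewrite /B (big_rem _ ql) /=.
  set Z := (\sum_(j <- _) _).
  have Z0 : 0 <= Z by apply: sumr_ge0 => j _; rewrite addr_ge0 ?nm_ge0.
  have := nm_ge0 (a q); have := nm_ge0 (e q) => h1 h2; split; lra.
apply: contrapT => no.
(* If no [z] exists, each candidate is either smaller than [x] or moved by [1 - q.1 *: T s] by more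
   than the fraction [c] of its size. *)
have key q P : q \in l -> nm (bop_horner (T s) P) <= B ->
    let z := bop_horner (T s) P * x in
    ess z < ess x \/ c * ess z < ess ((1 - q.1 *: T s) * z).
  move=> ql zB z; have [zx|zx] := ltP (ess z) (ess x); first by left.
  right; rewrite ltNge; apply/negP => bad; apply: no.
  have [q1 _] := lP q ql.
  have q0 : q.1 != 0 by rewrite -normr_gt0 q1.
  have nq : nm q.1^-1 = 1 by apply: norm1_nm; rewrite normfV q1 invr1.
  exists q.1^-1, z; split.
  - exact: nq.
  - by apply: commutantM; [exact: commutant_horner|exact: xc].
  - exact: zx.
  - have -> : T s * z - q.1^-1 *: z = - q.1^-1 *: ((1 - q.1 *: T s) * z).
      rewrite mulrBl mul1r -bop_scalerAl scalerBr scaleNr scalerA.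
      by rewrite mulNr mulVf// scaleN1r opprK addrC.
    by rewrite (le_trans _ bad)// -[leRHS]mul1r essZ// nmN nq.
  move=> y yc; rewrite mulrA (bop_horner_comm _ (yc s)) -mulrA.
  by rewrite (le_trans (essMl _ _))// ler_wpM2r ?ess_ge0.
set X := ess x in x0 key *.
(* [key] is used twice, each time at the cost of a factor [c]: from a bound on
   [(1 - q.1 *: T s) * (e q * x)] to one on [e q * x], and from there to [a q * x]. *)
have aX q : q \in l -> c ^+ 2 * ess (a q * x) <= 8 * X.
  move=> ql; have [q1 qE] := lP q ql; have [aqB eqB] := aB q ql.
  have := key q q.2 ql aqB; rewrite /= mulrA -/(a q) -/(e q).
  have := key q _ ql; rewrite /= => /(_ ((1 - q.1%:P * 'X) * q.2)).
  rewrite -eE => /(_ eqB).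
  have exc : commutant (e q * x).
    by apply: commutantM => //; rewrite eE; exact: commutant_horner.
  (* Moving from radius 1 to radius [r] costs [d]; at radius [r] the product formula of
     [unity_root_factors] applies. *)
  have h1 : ess ((1 - q.1 *: T s) * (e q * x)) <=
      ess ((1 - (r%:C * q.1) *: T s) * (e q * x)) + d * ess (e q * x).
    have -> : (1 - q.1 *: T s) * (e q * x) =
      (1 - (r%:C * q.1) *: T s) * (e q * x) +
      (- (d%:C * q.1)) *: (T s * (e q * x)).
      rewrite bop_scalerAl -mulrDl; congr (_ * _).
      rewrite -[RHS]addrA; congr (1 + _); rewrite -!scaleNr -scalerDl.
      have rd : r%:C + d%:C = 1 by rewrite -rmorphD /r subrK.
      by congr (_ *: _); rewrite -scalerDl -opprD rd scaleN1r.
    rewrite (le_trans (essD _ _))// lerD2l -(ess_repl s exc) essZ//.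
    by rewrite nmN nmM nmR (ger0_norm (ltW d0)) (norm1_nm q1) mulr1.
  have h2 : ess ((1 - (r%:C * q.1) *: T s) * (e q * x)) <= 4 * X.
    have -> : (1 - (r%:C * q.1) *: T s) * (e q * x) =
        (1 - T s ^+ (2 ^ m)) * ((1 - (r%:C ^+ (2 ^ m)) *: T s ^+ (2 ^ m)) * x).
      rewrite eE -[T s in LHS](bop_hornerX (T s)) -bop_horner1B bop_hornerX.
      rewrite mulrA -bop_hornerM qE bop_hornerM bop_horner1B bop_hornerXn.
      by rewrite -[T s ^+ _]scale1r -bop_hornerXn -bop_horner1B polyC1 mul1r mulrA.
    have h (b : R[i]) y : nm b <= 1 -> commutant y ->
        ess ((1 - b *: T s ^+ (2 ^ m)) * y) <= 2 * ess y.
      move=> b1 yc; rewrite mulrBl mul1r (le_trans (essB _ _))//.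
      rewrite mulr_natl mulr2n lerD2l -bop_scalerAl rep_pow.
      rewrite -(ess_repl (s *+ 2 ^ m) yc).
      by rewrite -[leRHS]mul1r; apply: essZ.
    rewrite -[X in 1 - X]scale1r (le_trans (h _ _ _ _)) ?nm1//.
      apply: commutantM => //.
      by rewrite -bop_hornerXn -bop_horner1B; exact: commutant_horner.
    have : nm (r%:C ^+ (2 ^ m) : R[i]) <= 1.
      by rewrite -rmorphXn /= nmR ger0_norm ?exprn_ge0// exprn_ile1// ltW.
    move=> /h/(_ xc); rewrite -/X; lra.
  have dc : d <= c / 16 by rewrite /d expr2 ler_pM2r// ler_piMr// ltW.
  set A := ess (a q * x); set D := ess (e q * x) in h1 *.
  have D0 : 0 <= D := ess_ge0 _.
  move=> hD hA.
  have cD : c * D <= 8 * X.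
    case: hD => hD.
      have : c * D <= D by rewrite ler_piMl.
      lra.
    have : d * D <= c / 16 * D by rewrite ler_wpM2r.
    lra.
  have A0 : 0 <= A := ess_ge0 _.
  rewrite expr2 -mulrA; case: hA => hA.
    have : c * A <= A by rewrite ler_piMl.
    have : c * (c * A) <= c * A by rewrite ler_piMl// mulr_ge0// ltW.
    lra.
  have : c * (c * A) <= c * D by rewrite ler_pM2l// ltW.
  lra.
pose N := (2 ^ m)%N.
have N0 : 0 < N%:R :> R by rewrite ltr0n expn_gt0.
(* The partial fraction identity applied to [x]. Its right side has size N (1 - r^N) [ess x], more
   than N/2 times [ess x], whereas [aX] bounds the left side by N/2 times [ess x]. *)
have sumE : \sum_(q <- l) (q.1 * (r%:C - 1)) *: (T s * (a q * x)) =
    (N%:R * (r%:C ^+ N - 1)) *: (T s ^+ N * x).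
  have := congr1 (bop_horner (T s)) lS.
  rewrite bop_horner_sum mul_polyC bop_hornerZ bop_hornerXn => /(congr1 ( *%R^~ x)).
  rewrite -bop_scalerAl => <-; rewrite mulr_suml; apply: eq_bigr => q _.
  by rewrite mul_polyC -scalerAl bop_hornerZ bop_hornerM bop_hornerX -bop_scalerAl mulrA.
have up : ess (\sum_(q <- l) (q.1 * (r%:C - 1)) *: (T s * (a q * x))) <=
    N%:R * (X / 2).
  rewrite (le_trans (ess_sum _ _))// (@le_trans _ _ (\sum_(q <- l) X / 2))//.
    rewrite big_seq [leRHS]big_seq; apply: ler_sum => q ql.
    have axc : commutant (a q * x).
      by apply: commutantM => //; exact: commutant_horner.
    have [q1 _] := lP q ql.
    have nqd : nm (q.1 * (r%:C - 1)) = d.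
      rewrite nmM (norm1_nm q1) mul1r -[1]/(1%:C) -rmorphB /= nmR.
      by rewrite distrC ger0_norm /r; lra.
    have nqd' : nm (q.1 * (r%:C - 1)) <= d by rewrite nqd.
    have := aX q ql; have := essZ (T s * (a q * x)) nqd'.
    rewrite ess_repl// /d; lra.
  by rewrite big_const_seq count_predT sl iter_addr_0 mulr_natl.
have Tx : ess (T s ^+ N * x) = X by rewrite rep_pow ess_repl.
pose k : R := N%:R * (1 - r ^+ N).
have k0 : 0 < k by rewrite mulr_gt0// subr_gt0 (lt_trans rm)//; lra.
have lo : ess (T s ^+ N * x) <= k^-1 * (N%:R * (X / 2)).
  rewrite sumE in up.
  rewrite (le_trans _ (ler_wpM2l _ up)) ?invr_ge0 ?(ltW k0)//.
  have kE : N%:R * (r%:C ^+ N - 1) = - k%:C :> R[i].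
    have kE' (b : R) n : n%:R * (b%:C ^+ n - 1) = - (n%:R * (1 - b ^+ n))%:C.
      by rewrite rmorphM rmorphB rmorphXn rmorph_nat rmorph1 /= -mulrN opprB.
    exact: kE'.
  have {1}-> : T s ^+ N * x =
      (- k^-1%:C) *: ((N%:R * (r%:C ^+ N - 1)) *: (T s ^+ N * x)).
    rewrite scalerA kE mulrNN -rmorphM /= mulVf ?gt_eqF//.
    by rewrite scale1r.
  by apply: essZ; rewrite nmN nmR ger0_norm ?invr_ge0// ltW.
move: lo; rewrite Tx ler_pdivlMl// /k -mulrA ler_pM2l// => lo.
have : (1 - r ^+ N) * X > 2^-1 * X by rewrite ltr_pM2r//; move: rm; rewrite -/N; lra.
lra.
Qed.

End EssentialSeminorm.

(** * Joint approximate eigenvectors and the limit character *)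

Section JointApproximateEigenvectors.
Variables (R : realType) (S : nmodType) (E : normedModType R[i]).
Variable T : S -> 'L(E).
Hypotheses (T_rep : representation T) (T_bounded : bounded_rep T).
Local Notation ess := (ess T).
Local Notation commutant := (commutant T).

Definition approx_eigen (L : seq S) (e : R) (f : S -> R[i]) (x : 'L(E)) :=
  [/\ commutant x, 0 < ess x &
    forall s, s \in L -> ess (T s * x - f s *: x) <= e * ess x].

Lemma approx_eigen_seq L e : 0 < e -> 0 < ess 1 ->
  exists f x, (forall s, nm (f s) = 1) /\ approx_eigen L e f x.
Proof.
move=> + ess10; elim: L e => [|s L IH] e e0.
  by exists (fun=> 1), 1; split; [move=> _; exact: nm1|split=> //; exact: commutant1].
have c0 : 0 < Num.min e 1 by rewrite lt_min e0 ltr01.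
have c1 : Num.min e 1 <= 1 by rewrite ge_min lexx orbT.
have [B B0 HB] := approx_eigen1 T_rep T_bounded s c0 c1.
have B1 : 0 < B + 1 by rewrite ltr_wpDl.
(* The precision anticipates the factor [B] lost when [x] is replaced by [z]. *)
have [f [x [f1 [xc x0 fx]]]] := IH _ (divr_gt0 e0 B1).
have [l [z [l1 zc xz lz zB]]] := HB x xc x0.
exists (fun t => if t == s then l else f t), z; split.
  by move=> t; case: ifP => // _; exact: f1.
have z0 : 0 < ess z by exact: lt_le_trans x0 xz.
split=> // t; rewrite inE; case: eqVneq => [->|ts] /= tL.
  by rewrite (le_trans lz)// ler_wpM2r ?(ltW z0)// ge_min lexx.
(* The operators [T t - f t] lie in the commutant, so the last clause of [approx_eigen1] carries the
   old relations from [x] to [z]. *)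
have := zB (T t - f t *: (1 : 'L(E))); rewrite !mulrBl -!bop_scalerAl !mul1r => h.
rewrite (le_trans (h _))//.
  move=> u; rewrite mulrBl mulrBr -bop_scalerAl mul1r -bop_scalerAr mulr1.
  by rewrite (rep_comm T_rep).
rewrite (le_trans (ler_wpM2l B0 (fx t tL)))// mulrCA mulrA.
rewrite (@le_trans _ _ (e * ess x))//; last by rewrite ler_wpM2l// ltW.
rewrite ler_wpM2r ?(ltW x0)// -mulrA ler_piMr ?(ltW e0)//.
by rewrite mulrC ler_pdivrMr// mul1r lerDl.
Qed.

(** Compactness of the disk provides a limit of the functions [f] along an ultrafilter. Only
    finitely many values matter at a time, so the eigenvectors of a nearby [f] serve the limit as
    well. *)
Lemma approx_eigen_char : 0 < ess 1 ->
  exists2 chi : S -> R[i], (forall s, `|chi s| = 1) &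
    forall L e, 0 < e -> exists x, approx_eigen L e chi x.
Proof.
move=> ess10.
pose eps n : R := n.+1%:R^-1.
have eps0 n : 0 < eps n by rewrite invr_gt0 ltr0n.
have /choice[f fP] : forall p : seq S * nat, exists f : S -> R[i]^o,
    (forall s, nm (f s) = 1) /\ exists x, approx_eigen p.1 (eps p.2) f x.
  move=> [L n]; have [f [x [f1 fx]]] := approx_eigen_seq L (eps0 n) ess10.
  by exists f; split=> //; exists x.
(* The filter of tails for growing lists and growing precision. *)
pose F : set_system (seq S * nat) := [set W | exists (L : seq S) (n : nat),
  forall (L' : seq S) (n' : nat), {subset L <= L'} -> (n <= n')%N -> W (L', n')].
have FF : ProperFilter F.
  split; first by move=> [L [n /(_ L n (fun=> id) (leqnn n))]].
  split; first by exists [::], 0%N.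
    move=> P Q [L [n P1]] [L' [n' Q1]]; exists (L ++ L'), (maxn n n').
    move=> K k LK; rewrite geq_max => /andP[nk n'k]; split.
      by apply: P1 => // s sL; apply: LK; rewrite mem_cat sL.
    by apply: Q1 => // s sL; apply: LK; rewrite mem_cat sL orbT.
  by move=> P Q PQ [L [n P1]]; exists L, n => L' n' LL' nn'; apply/PQ/P1.
have [G [GU FG]] := ultraFilterLemma FF.
have /choice[chi chiP] : forall s, exists z : R[i]^o, f p s @[p --> G] --> z.
  move=> s; have Gs := fmap_ultra (fun p => f p s) GU.
  have := @disk_compact R 1; rewrite compact_ultra => /(_ _ Gs).
  case; last by move=> z [_ zs]; exists z.
  by apply: (@filterS _ G _ setT) => [p _|]; [rewrite /= (fP p).1|exact: filterT].
have chiL (L : seq S) e : 0 < e -> \forall p \near G, forall s, s \in L ->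
    nm (f p s - chi s) < e.
  move=> e0; elim: L => [|s L IH]; first by apply: nearW.
  have /(@cvg_nm _ _ _ G _ (fun p => f p s))/(_ e e0) := chiP s.
  by apply: filterS2 IH => p IH sp t; rewrite inE => /orP[/eqP->|/IH].
exists chi => [s|L e e0].
  rewrite -nmE; suff -> : nm (chi s) = 1 by [].
  apply/le_anti/andP; split; apply/ler_addgt0Pr => e e0;
    have /filter_ex[p] := chiL [:: s] e e0; rewrite /= => /(_ s (mem_head _ _)) ps.
    have := nmD (chi s - f p s) (f p s); rewrite subrK nmC (fP p).1; lra.
  have := nmD (f p s - chi s) (chi s); rewrite subrK (fP p).1; lra.
have e2 : 0 < e / 2 by rewrite divr_gt0.
have [n ne] : exists n, eps n < e / 2.
  have [n _ nP] := near_infty_natSinv_lt (PosNum e2).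
  by exists n; exact: (nP n (leqnn n)).
have Gp : G [set p : seq S * nat | {subset L <= p.1} /\ (n <= p.2)%N].
  by apply: FG; exists L, n => L' n' LL' nn'; split.
have [p [[Lp np] pc]] := filter_ex (filterI Gp (chiL L _ e2)).
have [_ [x [xc x0 fx]]] := fP p; exists x; split=> // s sL.
(* Half of the error is that of [x] as an eigenvector for [f p], half is the distance of [f p s]
   from [chi s]. *)
have -> : T s * x - chi s *: x = (T s * x - f p s *: x) + (f p s - chi s) *: x.
  by rewrite scalerBl addrA subrK.
have pe : eps p.2 <= e / 2.
  by rewrite (le_trans _ (ltW ne))// lef_pV2 ?posrE ?ltr0n// ler_nat.
rewrite (le_trans (essD T_bounded _ _))// [e]splitr mulrDl lerD//.
  by rewrite (le_trans (fx s (Lp s sL)))// ler_wpM2r// ltW.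
by apply: essZ => //; rewrite ltW// pc.
Qed.

(** The relations for [s], [t] and [s + t] hold on a common approximate eigenvector, where they
    force the eigenvalues to multiply. *)
Lemma approx_eigen_unitary (chi : S -> R[i]) : (forall s, `|chi s| = 1) ->
  (forall L e, 0 < e -> exists x, approx_eigen L e chi x) ->
  unitary_character chi.
Proof.
move=> chi1 chiP.
have nchi s : nm (chi s) = 1 by exact: norm1_nm.
(* The 3 counts the relations combined below; precision [nm a / 4] then contradicts [a != 0]. *)
have small (a : R[i]) (L : seq S) : (forall x e, 0 < e -> approx_eigen L e chi x ->
    ess (a *: x) <= 3 * (e * ess x)) -> a = 0.
  move=> aP; apply/nm_eq0/le_anti; rewrite nm_ge0 andbT leNgt; apply/negP => a0.
  have a4 : 0 < nm a / 4 by rewrite divr_gt0.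
  have [x [xc x0 xL]] := chiP L _ a4.
  have h1 := aP _ _ a4 (And3 xc x0 xL).
  have : ess x <= (nm a)^-1 * ess (a *: x).
    have a0' : a != 0 by rewrite -nm_gt0.
    rewrite -{1}[x]scale1r -(mulVf a0') -scalerA; apply: essZ => //.
    by rewrite -[nm a^-1](mulKf (lt0r_neq0 a0)) -nmM mulfV// nm1 mulr1.
  rewrite ler_pdivlMl// => h2.
  have : nm a * ess x > 0 by rewrite mulr_gt0.
  lra.
split=> // [s t|].
  apply/subr0_eq/(small _ [:: s; t; s + t]) => x e e0 [xc x0 xL].
  have h1 := xL _ (mem_head _ _).
  have h2 : ess (T t * x - chi t *: x) <= e * ess x by apply: xL; rewrite !inE eqxx orbT.
  have h3 : ess (T (s + t) * x - chi (s + t) *: x) <= e * ess x.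
    by apply: xL; rewrite !inE eqxx !orbT.
  have tc : commutant (T t * x - chi t *: x).
    move=> u; rewrite mulrBl mulrBr -bop_scalerAl -bop_scalerAr xc -mulrA xc.
    by rewrite mulrA (rep_comm T_rep) mulrA.
  have -> : (chi (s + t) - chi s * chi t) *: x =
      (T s * (T t * x - chi t *: x) + chi t *: (T s * x - chi s *: x))
      - (T (s + t) * x - chi (s + t) *: x).
    rewrite mulrBr mulrA -T_rep.1 -bop_scalerAr scalerBr scalerA addrA subrK.
    by rewrite subrBB subrr sub0r opprB scalerBl [chi s * _]mulrC.
  rewrite (le_trans (essB T_bounded _ _))//.
  have := essD T_bounded (T s * (T t * x - chi t *: x)) (chi t *: (T s * x - chi s *: x)).
  rewrite (ess_repl T_rep T_bounded s tc).
  have : ess (chi t *: (T s * x - chi s *: x)) <= 1 * ess (T s * x - chi s *: x).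
    by apply: essZ => //; rewrite nchi.
  lra.
apply/subr0_eq/(small _ [:: 0]) => x e e0 [xc x0 xL].
have := xL 0 (mem_head _ _); rewrite T_rep.2 mul1r => h.
rewrite -(essN T_bounded) -scaleNr opprB scalerBl scale1r.
have : 0 <= e * ess x by rewrite mulr_ge0// ltW.
lra.
Qed.

(** Multiplied by an approximate eigenvector, the [P] term vanishes in the seminorm and the sum
    becomes too small. [P = 0] puts [chi] in the spectrum of [T]; a finite-rank spectral projection
    [P] leaves it in the spectrum on [ker P]. *)
Lemma approx_eigen_resolution (chi : S -> R[i]) (P : 'L(E))
    (l : seq ('L(E) * S)) :
  (forall L e, 0 < e -> exists x, approx_eigen L e chi x) ->
  (forall A : 'L(E), compact_operator (P * A)) ->
  1 <> P + \sum_(p <- l) p.1 * (chi p.2 *: (1 : 'L(E)) - T p.2).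
Proof.
move=> chiP Pc lE.
pose N := \sum_(p <- l) nm p.1.
have N0 : 0 <= N by apply: sumr_ge0 => p _; exact: nm_ge0.
have e0 : 0 < (N + 1)^-1 by rewrite invr_gt0 ltr_wpDl.
have [x [xc x0 xL]] := chiP [seq p.2 | p <- l] _ e0.
suff : ess x <= N * ((N + 1)^-1 * ess x).
  apply/negP; rewrite -ltNge mulrA -[ltRHS]mul1r ltr_pM2r//.
  by rewrite ltr_pdivrMr ?ltr_wpDl// mul1r ltrDl.
rewrite -{1}[x]mul1r {1}lE mulrDl (le_trans (essD T_bounded _ _))//.
rewrite (ess_compact T_bounded); last by move=> s; rewrite -mulrA; exact: Pc.
rewrite add0r mulr_suml (le_trans (ess_sum T_bounded _ _))//.
rewrite mulr_suml big_seq [leRHS]big_seq; apply: ler_sum => p pl.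
rewrite -mulrA (le_trans (essMl T_bounded _ _))// ler_wpM2l ?nm_ge0//.
rewrite mulrBl -bop_scalerAl mul1r -(essN T_bounded) opprB.
by apply: xL; apply: map_f.
Qed.

End JointApproximateEigenvectors.

Lemma nm_unit_ball (R : realType) (E : normedModType R[i]) (D : 'L(E)) (r : R) :
  (forall x : E, nm x <= 1 -> nm (D x) <= r) -> nm D <= r.
Proof.
move=> Dr; rewrite nm_opnorm; apply: ge_sup; first exact: (opnorm_has_sup D).1.
by move=> _ [x /= x1 <-]; have := Dr x; rewrite -le_nm => /(_ x1); rewrite unlock.
Qed.

(** * Uniform mean ergodic projections *)

Section MeanErgodic.
Variables (R : realType) (S : nmodType) (E : completeNormedModType R[i]).
Variable U : S -> 'L(E).
Hypotheses (U_rep : representation U).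
Variable M : R.
Hypothesis U_le : forall s, nm (U s) <= M.
Implicit Types (C D : 'L(E)) (x y : E) (s t u : S).

Let M0 : 0 <= M. Proof. exact: le_trans (nm_ge0 _) (U_le 0). Qed.

Lemma rep0 x : U 0 x = x.
Proof. by rewrite U_rep.2. Qed.

Lemma repD s t x : U (s + t) x = U s (U t x).
Proof. by rewrite U_rep.1. Qed.

(* [C] is a contraction for the equivalent norm sup_t |U t x|. *)
Definition rep_contraction C := forall x (r : R), (forall t, nm (U t x) <= r) ->
  forall t, nm (U t (C x)) <= r.

(* A stand-in for membership in the convex hull of the range of [U]. *)
Definition averaging C := [/\ rep_contraction C, commutant U C &
  exists l : seq ('L(E) * S), 1 - C = \sum_(p <- l) p.1 * (1 - U p.2)].

Lemma averaging_le C : averaging C -> nm C <= M.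
Proof.
move=> [Cc _ _]; apply/nm_bopP => // x; rewrite -(rep0 (C x)); apply: Cc => t.
by rewrite (le_trans (nm_bop _ _))// ler_wpM2r ?nm_ge0.
Qed.

Lemma averaging1 : averaging 1.
Proof.
split; [by []|exact: commutant1|exists [::]].
by rewrite big_nil subrr.
Qed.

Lemma averagingM C D : averaging C -> averaging D -> averaging (C * D).
Proof.
move=> [Cc Cm [l lC]] [Dc Dm [l' lD]]; split.
- by move=> x r xr; apply: Cc; exact: Dc.
- exact: commutantM.
exists ([seq (C * p.1, p.2) | p <- l'] ++ l); rewrite big_cat big_map -lC /=.
have -> : \sum_(p <- l') C * p.1 * (1 - U p.2) = C * (1 - D).
  by rewrite lD mulr_sumr; apply: eq_bigr => p _; rewrite mulrA.
by rewrite mulrBr mulr1 addrC addrA subrK.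
Qed.

Definition cesaro n t : 'L(E) :=
  (n.+1%:R^-1 : R)%:C *: \sum_(k < n.+1) U (t *+ k).

Lemma cesaro_averaging n t : averaging (cesaro n t).
Proof.
have n0 : n.+1%:R != 0 :> R by rewrite pnatr_eq0.
split.
- move=> x r xr u; rewrite bopZ bop_sum linearZ /= nmZ nmR ger0_norm ?invr_ge0 ?ler0n//.
  rewrite ler_pdivrMl ?ltr0n// linear_sum /= (le_trans (nm_sum _ _ _))//.
  rewrite (@le_trans _ _ (\sum_(k < n.+1) r))//.
    by apply: ler_sum => k _; rewrite -repD.
  by rewrite sumr_const card_ord mulr_natl.
- move=> s; rewrite -bop_scalerAl -bop_scalerAr mulr_suml mulr_sumr.
  by congr (_ *: _); apply: eq_bigr => k _; exact: rep_comm.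
exists [seq ((n.+1%:R^-1 : R)%:C *: (1 : 'L(E)), t *+ k) | k <- iota 0 n.+1].
rewrite big_map -[iota _ _]/(index_iota 0 n.+1) big_mkord /=.
under eq_bigr do rewrite -bop_scalerAl mul1r.
rewrite -scaler_sumr sumrB scalerBr; congr (_ - _).
have nE : (1 : 'L(E)) *+ n.+1 = (n.+1%:R : R)%:C *: (1 : 'L(E)).
  by rewrite rmorph_nat scaler_nat.
by rewrite sumr_const card_ord nE scalerA -rmorphM /= mulVf// scale1r.
Qed.

Lemma cesaro_le n t : nm (cesaro n t * (1 - U t)) <= n.+1%:R^-1 * (M + M).
Proof.
have -> : cesaro n t * (1 - U t) =
    (n.+1%:R^-1 : R)%:C *: (U 0 - U (t *+ n.+1)).
  rewrite -bop_scalerAl; congr (_ *: _).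
  elim: n => [|n IH]; first by rewrite big_ord1 mulr0n U_rep.2 mul1r mulr1n.
  rewrite big_ord_recr /= mulrDl IH mulrBr mulr1 -U_rep.1 -[t *+ n.+1 + t]mulrSr.
  by rewrite addrA subrK.
rewrite nmZ nmR ger0_norm ?invr_ge0 ?ler0n// ler_wpM2l ?invr_ge0 ?ler0n//.
by rewrite (le_trans (nmD _ _))// nmN lerD.
Qed.

(** A product of Cesaro means, one for each entry of [L]: the factors commute, each handles its own
    entry, and the others cost at most [M]. *)
Lemma averaging_ex (L : seq S) (e : R) : 0 < e ->
  exists2 C, averaging C & forall t, t \in L -> nm (C * (1 - U t)) <= e.
Proof.
elim: L e => [|s L IH] e e0; first by exists 1 => //; exact: averaging1.
have M1 : 0 < M + 1 by rewrite ltr_wpDl.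
have [C Ca CL] := IH _ (divr_gt0 e0 M1).
pose b := M * (M + M) + 1.
have b0 : 0 < b by rewrite ltr_wpDl// mulr_ge0// addr_ge0.
have [n _ nP] := near_infty_natSinv_lt (PosNum (divr_gt0 e0 b0)).
have {nP} nP : n.+1%:R^-1 < e / b := nP n (leqnn n).
have Aa := cesaro_averaging n s.
exists (cesaro n s * C) => [|t]; first exact: averagingM.
rewrite inE => /orP[/eqP->|tL].
  have -> : cesaro n s * C * (1 - U s) = C * (cesaro n s * (1 - U s)).
    have [_ Cm _] := Ca.
    rewrite mulrA; congr (_ * _); rewrite -bop_scalerAl -bop_scalerAr.
    rewrite mulr_suml mulr_sumr; congr (_ *: _); apply: eq_bigr => k _.
    by rewrite Cm.
  rewrite (le_trans (nm_comp _ _))//.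
  rewrite (@le_trans _ _ (M * (n.+1%:R^-1 * (M + M))))//.
    by rewrite ler_pM ?nm_ge0 ?cesaro_le ?averaging_le.
  rewrite mulrCA (@le_trans _ _ (n.+1%:R^-1 * b))//.
    by rewrite ler_wpM2l ?invr_ge0 ?ler0n// /b lerDl.
  by rewrite -ler_pdivlMr// ltW.
rewrite -mulrA (le_trans (nm_comp _ _))//.
rewrite (@le_trans _ _ (M * (e / (M + 1))))//.
  by rewrite ler_pM ?nm_ge0 ?CL ?averaging_le.
by rewrite mulrA ler_pdivrMr// mulrC ler_pM2l// lerDl.
Qed.

Lemma averaging_fix C x : averaging C -> (forall t, U t x = x) -> C x = x.
Proof.
move=> [_ _ [l lC]] Ux; apply/esym/subr0_eq.
rewrite -[x - C x]/((1 - C : 'L(E)) x) lC bop_sum big1// => p _.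
by rewrite bopM bopD bopN bop1 Ux subrr linear0.
Qed.

Variables (s0 : S) (K : 'L(E)).
Hypotheses (K_compact : compact_operator K) (K_lt : nm (U s0 - K) < 1).

(** Powers of [U s0 - K] tend to 0 and differ from powers of [U s0] by compact operators. *)
Lemma quasi_compact_small (e : R) : 0 < e ->
  exists t K', compact_operator K' /\ nm (U t - K') <= e.
Proof.
move=> e0; have [n nP] := nm_exp_cvg0 1 (nm_ge0 _) K_lt e0.
exists (s0 *+ n), (U s0 ^+ n - (U s0 - K) ^+ n).
split; first exact: compact_op_pow.
rewrite -(rep_pow U_rep) opprB addrC subrK.
have := nP n (leqnn n); rewrite mulr1 => /ltW; apply: le_trans.
by apply/nm_bopP => [|x]; [rewrite exprn_ge0 ?nm_ge0|exact: nm_powbop].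
Qed.

(** A fixed [x] equals [U t x] and so is close to [K' x]; a net for the image of the unit ball under
    [K'] thus yields a half-radius net for the fixed unit ball, as [riesz_finite] asks. *)
Lemma fix_finite : exists s : seq E, [set x | forall t, U t x = x] = lspan s.
Proof.
have e0 : 0 < 8^-1 :> R by rewrite invr_gt0.
have [t [K' [K'c UK']]] := quasi_compact_small e0.
have [s sK] := @compact_op_net _ _ K' 1 _ K'c e0.
pose A x := (forall t, U t x = x) /\ nm x <= 1.
(* Moves net points into the fixed unit ball, at the price of doubling the error 1/4. Points with no
   fixed vector nearby get the default [y] and are discarded by [good]. *)
have /choice[g gP] : forall y, exists x, (exists2 x, A x & nm (x - y) <= 4^-1) ->
    A x /\ nm (x - y) <= 4^-1.
  move=> y; have [[x Ax xy]|no] := pselect (exists2 x, A x & nm (x - y) <= 4^-1).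
    by exists x.
  by exists y => /no.
pose good y := `[< exists2 x, A x & nm (x - y) <= 4^-1 >].
exists [seq g y | y <- s & good y]; apply: riesz_finite.
- by move=> x y Ux Uy u; rewrite linearD /= Ux Uy.
- by move=> a x Ux u; rewrite linearZ /= Ux.
- by move=> u; rewrite linear0.
- move=> _ /mapP[y + ->]; rewrite mem_filter => /andP[/asboolP/gP[[gy _] _] _].
  exact: gy.
move=> x Ux x1; have [y ys xy] := sK x x1.
have xy4 : nm (x - y) <= 4^-1.
  rewrite (le_trans (nm_dist (K' x) _ _))//.
  have : nm (x - K' x) <= 8^-1.
    rewrite -{1}(Ux t) -[_ - _]/((U t - K' : 'L(E)) x).
    rewrite (le_trans (nm_bop _ _))// -[leRHS]mulr1.
    by rewrite ler_pM ?nm_ge0.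
  lra.
have gy : exists2 x, A x & nm (x - y) <= 4^-1 by exists x.
exists (g y); first by apply/map_f; rewrite mem_filter ys andbT; apply/asboolP.
have [_ gyy] := gP y gy.
by rewrite (le_trans (nm_dist y _ _))// [nm (y - _)]nmC; lra.
Qed.

(* The averages converge pointwise along an ultrafilter by compactness, and
   then in norm because they are nearly [C * K'] with [K'] compact. *)
Lemma mean_ergodic : exists P C : 'L(E),
  [/\ P * P = P, forall s, P * U s = U s * P,
      range P = [set x | forall t, U t x = x],
      averaging C & nm (C - P) < 1].
Proof.
(* Tails of the averages, for growing [L] and shrinking [e]; [averaging_ex] makes them nonempty. *)
pose F : set_system 'L(E) := [set W | exists (L : seq S) (e : R), 0 < e /\
  forall C, averaging C -> (forall t, t \in L -> nm (C * (1 - U t)) <= e) -> W C].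
have FF : ProperFilter F.
  split.
    move=> [L [e [e0 We]]]; have [C Ca CL] := averaging_ex L e0.
    exact: We Ca CL.
  split; first by exists [::], 1.
    move=> W W' [L [e [e0 We]]] [L' [e' [e'0 We']]].
    exists (L ++ L'), (Num.min e e'); split; first by rewrite lt_min e0.
    move=> C Ca CL; split; [apply: We => // t tL|apply: We' => // t tL].
      by rewrite (le_trans (CL t _))// ?mem_cat ?tL// ge_min lexx.
    by rewrite (le_trans (CL t _))// ?mem_cat ?tL ?orbT// ge_min lexx orbT.
  move=> W W' WW' [L [e [e0 We]]]; exists L, e; split=> // C Ca CL.
  exact/WW'/We.
have [G [GU FG]] := ultraFilterLemma FF.
have Ga : \forall C \near G, averaging C by apply: FG; exists [::], 1.
have Gs t (e : R) : 0 < e -> \forall C \near G, nm (C * (1 - U t)) <= e.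
  by move=> e0; apply: FG; exists [:: t], e; split=> // C _; apply; rewrite mem_head.
have /choice[P0 P0P] : forall x, exists y, (C : 'L(E)) x @[C --> G] --> y.
  move=> x; suff /cauchy_cvgP/cvg_ex[y yP] : cauchy ((C : 'L(E)) x @[C --> G]).
    by exists y.
  apply: cauchy_exP => _ /gt0_real[e e0 ->].
  have nx := nm_ge0 x.
  have x1 : 0 < nm x + 1 by rewrite ltr_wpDl.
  have Mx : 0 <= M * nm x by rewrite mulr_ge0.
  have Mx1 : 0 < M * nm x + 1 by rewrite ltr_wpDl.
  have e3 : 0 < e / 3 by rewrite divr_gt0.
  (* [C x] is close to [U t (C x)], hence to [K' (C x)], which converges by compactness; each of the
     three steps costs e/3. *)
  have [t [K' [K'c UK']]] := quasi_compact_small (divr_gt0 e3 Mx1).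
  have [B Bc KB] := compact_op_ball (M * nm x) K'c.
  move: Bc; rewrite compact_ultra => /(_ _ (fmap_ultra (fun C : 'L(E) => K' (C x)) GU)).
  have Cx C : averaging C -> nm (C x) <= M * nm x.
    by move=> Ca; rewrite (le_trans (nm_bop _ _))// ler_wpM2r// averaging_le.
  case; first by apply: filterS Ga => C Ca /=; apply: KB; exact: Cx.
  move=> z [_ /(@cvg_nm _ _ _ G _ (fun C : 'L(E) => K' (C x)))/(_ _ e3) zP].
  exists z; rewrite /= /fmap /=.
  have Gt := Gs t _ (divr_gt0 e3 x1).
  apply: filterS3 Ga Gt zP => C Ca Ct Cz.
  suff : nm (z - C x) < e by rewrite -ball_nm.
  have h1 : nm (C x - U t (C x)) <= e / 3.
    have [_ Cm _] := Ca.
    have -> : C x - U t (C x) = (C * (1 - U t) : 'L(E)) x.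
      by rewrite mulrBr mulr1 Cm.
    rewrite (le_trans (nm_bop _ _))//.
    rewrite (le_trans (ler_wpM2r nx Ct))// mulrAC ler_pdivrMr// ler_wpM2l ?(ltW e3)//.
    by rewrite lerDl.
  have h2 : nm (U t (C x) - K' (C x)) <= e / 3.
    rewrite -[_ - _]/((U t - K' : 'L(E)) (C x)) (le_trans (nm_bop _ _))//.
    rewrite (@le_trans _ _ (e / 3 / (M * nm x + 1) * (M * nm x)))//.
      by rewrite ler_pM ?nm_ge0// Cx.
    by rewrite mulrAC ler_pdivrMr// ler_wpM2l ?(ltW e3)// lerDl.
  move: Cz => /=.
  have := nm_dist (K' (C x)) z (C x); rewrite [nm (z - K' _)]nmC [nm (K' _ - C x)]nmC.
  have := nm_dist (U t (C x)) (C x) (K' (C x)).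
  lra.
have uniq (f : 'L(E) -> E) y z : f C @[C --> G] --> y -> f C @[C --> G] --> z -> y = z.
  by move=> fy fz; exact: (cvg_unique (@norm_hausdorff _ _) fy fz).
have P0l : linear P0.
  move=> a x y; apply: (uniq (fun C => C (a *: x + y))) => //.
  under eq_fun do rewrite linearP.
  by apply: cvgD; [apply: cvgZl_tmp; exact: P0P|exact: P0P].
have P0M x : nm (P0 x) <= M * nm x.
  apply/ler_addgt0Pr => e e0.
  have /(@cvg_nm _ _ _ G _ (fun C : 'L(E) => C x))/(_ e e0) Px := P0P x.
  have [C [Ca Ce]] := filter_ex (filterI Ga Px).
  have := nm_dist (C x) (P0 x) 0; rewrite !subr0 nmC => h.
  have : nm (C x) <= M * nm x.
    by rewrite (le_trans (nm_bop _ _))// ler_wpM2r ?nm_ge0 ?averaging_le.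
  lra.
have [P PE] := bop_of P0l P0M.
have PC x : (C : 'L(E)) x @[C --> G] --> P x by rewrite PE; exact: P0P.
have UP t x : U t (P x) = P x.
  apply: (uniq (fun C => U t (C x))).
    by apply: continuous_cvg => //; exact: bop_continuous.
  apply/cvg_nm => e e0.
  have x1 : 0 < nm x + 1 by rewrite ltr_wpDl ?nm_ge0.
  have e2 : 0 < e / 2 by rewrite divr_gt0.
  have /(@cvg_nm _ _ _ G _ (fun C : 'L(E) => C x))/(_ _ e2) Px := PC x.
  apply: filterS3 Ga (Gs t _ (divr_gt0 e2 x1)) Px => C Ca Ct Cx.
  have h1 : nm (C x - U t (C x)) <= e / 2.
    have [_ Cm _] := Ca.
    have -> : C x - U t (C x) = (C * (1 - U t) : 'L(E)) x.
      by rewrite mulrBr mulr1 Cm.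
    rewrite (le_trans (nm_bop _ _))//.
    rewrite (le_trans (ler_wpM2r (nm_ge0 x) Ct))// mulrAC ler_pdivrMr//.
    by rewrite ler_wpM2l ?(ltW e2)// lerDl.
  have := nm_dist (C x) (U t (C x)) (P x); rewrite [nm (U t _ - C x)]nmC.
  lra.
have PU t : P * U t = U t * P.
  apply: bop_ext => x; rewrite !bopM; apply: (uniq (fun C => C (U t x))) => //.
  have : U t ((C : 'L(E)) x) @[C --> G] --> U t (P x).
    apply: (@cvg_comp _ _ _ (fun C : 'L(E) => C x) (U t) G _ _ (PC x)).
    exact: bop_continuous.
  apply: cvg_trans; apply: near_eq_cvg; apply: filterS Ga => C [_ Cm _].
  by rewrite -!bopM Cm.
have fixP x : (forall t, U t x = x) -> P x = x.
  move=> Ux; apply: (uniq (fun C => C x)) => //.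
  apply: cvg_near_cst; apply: filterS Ga => C Ca.
  exact: averaging_fix Ca Ux.
have PM : nm P <= M by apply/nm_bopP => // x; rewrite PE.
have [C Ca CP] : exists2 C, averaging C & nm (C - P) < 1.
  have e0 : 0 < 4^-1 :> R by rewrite invr_gt0.
  have M2 : 0 < M + M + 1 by rewrite ltr_wpDl// addr_ge0.
  have d0 := divr_gt0 e0 M2.
  have dM : (M + M) * (4^-1 / (M + M + 1)) <= 4^-1.
    by rewrite mulrCA ler_piMr ?(ltW e0)// ler_pdivrMr// mul1r lerDl.
  have [t [K' [K'c UK']]] := quasi_compact_small d0.
  have [s sK] := @compact_op_net _ _ K' 1 _ K'c d0.
  have Gy : \forall C \near G, forall y, y \in s ->
      nm ((C : 'L(E)) y - P y) < 4^-1 / 2.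
    have e8 : 0 < 4^-1 / 2 :> R by rewrite divr_gt0.
    elim: s {sK} => [|y s IH]; first by apply: nearW.
    have /(@cvg_nm _ _ _ G _ (fun C : 'L(E) => C y))/(_ _ e8) := PC y.
    by apply: filterS2 IH => C Cs Cy z; rewrite inE => /orP[/eqP->|/Cs].
  have [C [[Ca Ct] Cs]] := filter_ex (filterI (filterI Ga (Gs t _ e0)) Gy).
  exists C => //.
  have CPM : nm (C - P) <= M + M.
    by rewrite (le_trans (nmD _ _))// nmN lerD// averaging_le.
  (* Uses [P * U t = P]. The first term is small because [C - P] is small on a finite net for the
     image under [K']; the bounds add up to 3/8 + 1/4 + 1/4 < 1. *)
  have -> : C - P = (C - P) * K' + (C - P) * (U t - K') + C * (1 - U t).
    have UtP : U t * P = P by apply: bop_ext => x; exact: UP.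
    rewrite -mulrDr [K' + _]addrC subrK mulrBl mulrBr mulr1 PU UtP.
    by rewrite [RHS]addrC addrA subrK.
  have h1 : nm ((C - P) * K') <= 4^-1 + 4^-1 / 2.
    apply: nm_unit_ball => x x1; have [y ys xy] := sK x x1.
    rewrite bopM -[K' x](subrK y) linearD (le_trans (nmD _ _))// lerD//.
      rewrite (le_trans (nm_bop _ _))// (le_trans _ dM)// ler_pM ?nm_ge0//.
      exact: ltW.
    by apply: ltW; exact: Cs.
  have h2 : nm ((C - P) * (U t - K')) <= 4^-1.
    by rewrite (le_trans (nm_comp _ _))// (le_trans _ dM)// ler_pM ?nm_ge0.
  rewrite (le_lt_trans (nmD _ _))//.
  have := nmD ((C - P) * K') ((C - P) * (U t - K')).
  lra.
exists P, C; split=> //.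
- by apply: bop_ext => x; rewrite bopM; apply: fixP => t.
- apply/seteqP; split=> [_ [x _ <-] t|x Ux]; first exact: UP.
  by exists x => //; exact: fixP.
Qed.

End MeanErgodic.

(** * Passing between operators on [E] and on [ker P] *)

Section Compression.
Variables (R : realType) (E : normedModType R[i]).
Variables (P : 'L(E)).
Hypothesis PP : P * P = P.

Lemma ker_compl (x : E) : (1 - P : 'L(E)) x \in bop_ker P.
Proof.
apply/eqP; rewrite -[LHS]/((P * (1 - P) : 'L(E)) x).
by rewrite mulrBr mulr1 PP subrr.
Qed.

Definition ker_proj (x : E) : subsp (bop_ker P) :=
  exist (fun y => y \in bop_ker P) _ (ker_compl x).

Lemma ker_projK (x : subsp (bop_ker P)) : ker_proj (val x) = x.
Proof.
apply: val_inj => /=; rewrite bopD bopN bop1.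
by have /eqP -> := valP x; rewrite subr0.
Qed.

Lemma nm_subsp (F : submodClosed E) (x : subsp F) : nm x = nm (val x).
Proof. by rewrite unlock. Qed.

(** [A] need not preserve [ker P], so its values are projected back by [1 - P]. *)
Lemma bop_compress (A : 'L(E)) :
  {B : 'L(subsp (bop_ker P)) | forall x, B x = ker_proj (A (val x))}.
Proof.
apply: (@bop_of _ _ _ (nm (1 - P) * nm A)).
  by move=> a x y; apply: val_inj; rewrite /= linearP /= linearP.
move=> x; rewrite !nm_subsp /= -mulrA (le_trans (nm_bop _ _))//.
by rewrite ler_wpM2l ?nm_ge0// nm_bop.
Qed.

Lemma bop_extend (B : 'L(subsp (bop_ker P))) :
  {A : 'L(E) | forall x, A x = val (B (ker_proj x))}.
Proof.
apply: (@bop_of _ _ _ (nm B * nm (1 - P))) => [a x y|x].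
  have -> : ker_proj (a *: x + y) = a *: ker_proj x + ker_proj y.
    by apply: val_inj; rewrite /= linearP.
  by rewrite linearP.
rewrite -nm_subsp -mulrA (le_trans (nm_bop _ _))// ler_wpM2l ?nm_ge0//.
by rewrite nm_subsp /= nm_bop.
Qed.

End Compression.

(** * The two implications *)

Section Main.
Variables (R : realType) (S : nmodType) (E : completeNormedModType R[i]).
Variable T : S -> 'L(E).
Hypotheses (T_rep : representation T) (T_bounded : bounded_rep T).

Lemma riesz_quasi_compact :
  (forall chi, uni_spectrum T chi -> riesz_point T chi) -> quasi_compact T.
Proof.
move=> riesz; apply: contrapT => nqc.
have ess10 : 0 < ess T 1 by exact: lt_le_trans ltr01 (ess1 T_bounded nqc).
have [chi chi1 chiP] := approx_eigen_char T_rep T_bounded ess10.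
have chiU := approx_eigen_unitary T_rep T_bounded chi1 chiP.
have /riesz[[_ [P [PT [PP Pker nspec]]]] fin] : uni_spectrum T chi.
  split=> //; apply/left_ideal_gen_full => -[l l1].
  have := @approx_eigen_resolution _ _ _ _ T_bounded chi 0 l chiP.
  rewrite add0r; apply => // A; rewrite mul0r; exact: compact_op0.
apply: nspec; split=> //; apply/left_ideal_gen_full => -[l l1].
(* Extending the coefficients through [1 - P] turns a decomposition of the identity of [ker P] into
   one of [1 - P] on [E], excluded by [approx_eigen_resolution]. *)
pose ext B := sval (bop_extend PP B).
have extE B x : ext B x = val (B (ker_proj PP x)) by exact: (svalP (bop_extend PP B)).
apply: (@approx_eigen_resolution _ _ _ _ T_bounded chi P
  [seq (ext p.1, p.2) | p <- l] chiP).
  have [s sP] := finite_dimensional_lspan fin.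
  move=> A; apply: (@finite_rank_compact _ _ s) => x; apply: sP.
  by rewrite -Pker; exists (A x).
rewrite big_map -[LHS](subrK P) addrC; congr (_ + _); apply: bop_ext => x.
rewrite bop_sum -[LHS]/(val (ker_proj PP x)) -[ker_proj PP x]bop1 l1.
rewrite bop_sum raddf_sum; apply: eq_bigr => p _ /=.
rewrite bopM extE; congr (val (bop_fun p.1 _)); apply: val_inj => /=.
rewrite -[RHS]/(((1 - P) * (chi p.2 *: (1 : 'L(E)) - T p.2) : 'L(E)) x).
suff -> : (1 - P) * (chi p.2 *: (1 : 'L(E)) - T p.2) =
  (chi p.2 *: (1 : 'L(E)) - T p.2) * (1 - P) by [].
rewrite [LHS]mulrBl mul1r [RHS]mulrBr mulr1; congr (_ - _).
by rewrite mulrBl mulrBr PT -bop_scalerAl -bop_scalerAr mul1r mulr1.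
Qed.

Lemma quasi_compact_riesz chi : quasi_compact T -> unitary_character chi ->
  riesz_point T chi.
Proof.
move=> [s0 [K [Kc UK]]] chiU; have [chi1 chiD chi0] := chiU.
have c0 s : chi s != 0 by rewrite -normr_gt0 chi1.
have nchi s : nm (chi s)^-1 = 1 by apply: norm1_nm; rewrite normfV chi1 invr1.
(* Dividing by [chi] turns the eigenspace into a fixed space without changing any norm. *)
pose U s : 'L(E) := (chi s)^-1 *: T s.
have U_rep : representation U.
  split=> [s t|]; last by rewrite /U chi0 invr1 scale1r T_rep.2.
  by rewrite /U -bop_scalerAl -bop_scalerAr scalerA chiD T_rep.1 invfM.
have [M M0 TM] := rep_bound T_bounded.
have UM s : nm (U s) <= M by rewrite nmZ nchi mul1r.
have UKc : compact_operator ((chi s0)^-1 *: K) by exact: compact_opZ.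
have UKlt : nm (U s0 - (chi s0)^-1 *: K) < 1.
  by rewrite -scalerBr nmZ nchi mul1r -lt_nm.
have TE s : T s = chi s *: U s by rewrite scalerA mulfV// scale1r.
have fixE : [set x | forall t, U t x = x] = ker_char T chi.
  apply/seteqP; split=> x Ux s; first by rewrite TE bopZ Ux.
  by rewrite bopZ Ux scalerA mulVf// scale1r.
have [P [C [PP PU Prange [_ _ [l lC]] CP]]] := mean_ergodic U_rep UM UKc UKlt.
have PT s : P * T s = T s * P by rewrite TE -bop_scalerAl -bop_scalerAr PU.
split; last first.
  have [s fs] := fix_finite U_rep UKc UKlt.
  by rewrite -fixE fs; exact: lspan_finite_dimensional.
split=> //; exists P, PT; split=> //; first by rewrite Prange.
move=> [_ /left_ideal_gen_full]; apply.
(* On [ker P] the operator [1 - (C - P)] agrees with [1 - C], so [G] undoes [1 - C] there. *)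
have [G G1] := neumann CP.
pose cmp A := sval (bop_compress PP A).
have cmpE A x : cmp A x = ker_proj PP (A (val x)) by exact: (svalP (bop_compress PP A)).
have key A s (x : subsp (bop_ker P)) :
    val ((((chi s)^-1 *: cmp A) * (chi s *: (1 : 'L(subsp (bop_ker P))) -
      restr_rep (fun s => bop_ker_homo (PT s)) s) : 'L(subsp (bop_ker P))) x) =
    (1 - P : 'L(E)) ((A * (1 - U s) : 'L(E)) (val x)).
  transitivity ((chi s)^-1 *: (1 - P : 'L(E)) (A (chi s *: val x - T s (val x)))).
    by rewrite bopM bopZ cmpE.
  rewrite -!linearZ /= scalerBr scalerA mulVf// scale1r.
  by [].
(* The coefficients of [1 - C] multiplied by [G] and compressed to [ker P]; the inverse of [chi]
   accounts for [chi - T = chi (1 - U)]. *)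
exists [seq ((chi p.2)^-1 *: cmp (G * p.1), p.2) | p <- l].
rewrite big_map; apply: bop_ext => x; rewrite bop_sum bop1.
have Gx : val x = G ((1 - C : 'L(E)) (val x)).
  transitivity ((G * (1 - (C - P)) : 'L(E)) (val x)); first by rewrite G1.
  rewrite bopM; congr (bop_fun G _).
  rewrite !(bopD, bopN, bop1) opprD opprK.
  by have /eqP -> := valP x; rewrite addr0.
apply: val_inj; rewrite raddf_sum.
transitivity ((1 - P : 'L(E)) (G ((1 - C : 'L(E)) (val x)))).
  by rewrite -Gx; exact/esym/(congr1 val (ker_projK PP x)).
rewrite lC bop_sum linear_sum linear_sum; apply: eq_bigr => p _.
exact/esym/key.
Qed.

End Main.

Theorem theorem3p12 (R : realType) (S : nmodType)
    (E : completeNormedModType R[i]) (T : S -> 'L(E))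
    (T_rep : representation T) (T_bounded : bounded_rep T) :
  quasi_compact T <-> (forall chi, uni_spectrum T chi -> riesz_point T chi).
Proof.
split; last exact: riesz_quasi_compact.
by move=> qc chi [chiU _]; exact: quasi_compact_riesz.
Qed.
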